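(* Let $\lambda=(\lambda_j)_{j\in\mathbb{N}}\in(0,\frac12)^{\mathbb{N}}$ be a sequence such that $\lambda_n<\frac13$ for infinitely many $n$, $\lambda_n\ge\frac13$ for infinitely many $n$, and there is $k_0\in\mathbb{N}\cup\{0\}$ with $\lambda_{k_0+1}>\frac13$. Let $(k_n)_{n\in\mathbb{N}}$ be the increasing sequence of all indices $j>k_0$ with $\lambda_j<\frac13$. Let $k\ge k_0$, $t\in\{0,1,2\}^k$, and let $m\in\mathbb{N}$ be such that $k_{m-1}\le k<k_m$. Assume moreover that there exists a sequence $(\delta_n)_{n\in\mathbb{N}}$ of real numbers such that for every $n\in\mathbb{N}$ $$\left\{\begin{array}{l}3d_r-d_{r-1}=\delta_n \text{ whenever } k_{n-1}<r<k_n,\\ 4d_{k_n}=\delta_n+\delta_{n+1},\\ d_{k_n-1}-d_{k_n}=\delta_n-\delta_{n+1}.\end{array}\right.$$ Then: (1) $J_t\setminus\bigcup\mathcal{G}_t\subset C(\lambda)-C(\lambda)$. (2) The set $C(\lambda)-C(\lambda)$ is a Cantorval. (3) If $k=k_0=0$ and $t=\emptyset$, then $C(\lambda)-C(\lambda)=J_t\setminus\bigcup\mathcal{G}_t$ and $$|C(\lambda)-C(\lambda)|=2-2\sum_{n=1}^{\infty}3^{n-1}\left(d_{k_n-1}-3d_{k_n}\right).$$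
   Context: $\mathbb{N}=\{1,2,\dots\}$. $|A|$ is Lebesgue measure and $A-B=\{a-b:a\in A,b\in B\}$. Concatenation of finite sequences is written $s^\frown t$; $i^{(n)}$ is the sequence $(i,\dots,i)$ with $n$ terms; $s\prec t$ means that $t$ extends $s$ (i.e. $s$ is an initial segment of $t$). $\{0,1,2\}^0$ contains only the empty sequence $\emptyset$. Central Cantor set. For $\lambda\in(0,\frac12)^{\mathbb{N}}$ put $d_0=1$, $d_n=\lambda_1\cdots\lambda_n$. Let $I_\emptyset=I=[0,1]$. Given a closed interval $I_t$ of length $d_n$ with $t\in\{0,1\}^n$, remove from it the concentric open interval of length $(1-2\lambda_{n+1})d_n$; the left and right remaining components are $I_{t^\frown 0}$ and $I_{t^\frown 1}$, each of length $d_{n+1}$. Put $C_n(\lambda)=\bigcup_{t\in\{0,1\}^n}I_t$ and $C(\lambda)=\bigcap_{n\in\mathbb{N}}C_n(\lambda)$. Intervals $J_s$. $J_\emptyset=I-I=[-1,1]$; for $s\in\{0,1,2\}^n$, $J_s=I_t-I_p$ where $t,p\in\{0,1\}^n$ satisfy $s_i=t_i-p_i+1$ for $i=1,\dots,n$ (this does not depend on the choice of $t,p$). Thus $|J_s|=2d_n$, and $J_{s^\frown0},J_{s^\frown1},J_{s^\frown2}$ are the closed subintervals of $J_s$ of length $2d_{n+1}$ that respectively share the left endpoint, the center, and the right endpoint with $J_s$. Gaps. If $s\in\{0,1,2\}^n$ ($n\ge 0$) and $\lambda_{n+1}<\frac13$, then $J_s\setminus(J_{s^\frown0}\cup J_{s^\frown1}\cup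 J_{s^\frown2})$ is a union of two open intervals; the left one is $G_s^0$ and the right one is $G_s^1$. Families $\mathcal{G}_t$. With $\lambda$, $k_0$, $(k_n)$, $k\ge k_0$, $t\in\{0,1,2\}^k$ and $m$ with $k_{m-1}\le k<k_m$ as in the claim, put for $n\ge m$ $$\widetilde{\mathcal{G}_t}(n)=\left\{G^0_{t^\frown0^{(k_n-k-1)}},\,G^1_{t^\frown2^{(k_n-k-1)}}\right\}.$$ Define $\mathcal{G}_t(m)=\widetilde{\mathcal{G}_t}(m)$ and inductively, for $n\ge m$, $$\mathcal{G}_t(n+1)=\widetilde{\mathcal{G}_t}(n+1)\cup\bigcup_{l=m}^{n}\left(\left\{G^0_{s^\frown(i+1)^\frown0^{(k_{n+1}-k_l-1)}}:G_s^i\in\mathcal{G}_t(l)\right\}\cup\left\{G^1_{s^\frown i^\frown2^{(k_{n+1}-k_l-1)}}:G_s^i\in\mathcal{G}_t(l)\right\}\right),$$ where $\mathcal{G}_t(n)\subset\{G_s^i:s\in\{0,1,2\}^{k_n-1},i\in\{0,1\}\}$. Put $\mathcal{G}_t=\bigcup_{n\ge m}\mathcal{G}_t(n)$. Cantorval. A set is regular closed if it equals the closure of its interior. A nonempty regular closed bounded set $C\subset\mathbb{R}$ is a Cantorval if for every connected component $K$ of $C$ with nonempty interior, both endpoints of $K$ are accumulation points of the union of the one-point components of $C$. *)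

(* Defs.v *)
From HB Require Import structures.
From mathcomp Require Import all_boot all_order all_algebra.
From mathcomp Require Import all_classical all_reals all_analysis.
From mathcomp Require Import ring lra zify.

Set Implicit Arguments.
Unset Strict Implicit.
Unset Printing Implicit Defensive.

Import Order.TTheory GRing.Theory Num.Theory.
Import numFieldNormedType.Exports.

Local Open Scope classical_set_scope.
Local Open Scope ring_scope.

Definition set_diff {R : realType} (A B : set R) : set R :=
  [set a - b | a in A & b in B].

(* Sequences are indexed by the positive integers: [lam 0] is never used. *)
Definition dseq {R : realType} (lam : nat -> R) (n : nat) : R :=
  \prod_(1 <= j < n.+1) lam j.

(* [ab] holds the endpoints of an interval of generation [n]; the concentric
   open interval of length [(1 - 2 * lam n.+1) * dseq lam n] is removed and the
   left ([e = false]) or right ([e = true]) remaining component is returned. *)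
Definition child {R : realType} (lam : nat -> R) (n : nat) (ab : R * R)
    (e : bool) : R * R :=
  let c := (ab.1 + ab.2) / 2 in
  let g := (1 - 2 * lam n.+1) * dseq lam n in
  if e then (c + g / 2, ab.2) else (ab.1, c - g / 2).

Fixpoint descend {R : realType} (lam : nat -> R) (n : nat) (ab : R * R)
    (t : seq bool) : R * R :=
  if t is e :: t' then descend lam n.+1 (child lam n ab e) t' else ab.

Definition Iint {R : realType} (lam : nat -> R) (t : seq bool) : set R :=
  let ab := descend lam 0 (0, 1) t in [set` `[ab.1, ab.2]].

Definition Cstage {R : realType} (lam : nat -> R) (n : nat) : set R :=
  \bigcup_(t in [set t : seq bool | size t = n]) Iint lam t.

Definition central_cantor {R : realType} (lam : nat -> R) : set R :=
  \bigcap_(n in [set n | (0 < n)%N]) Cstage lam n.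

(* s_i = t_i - p_i + 1 for all i, written without subtraction *)
Definition compatible (s : seq 'I_3) (t p : seq bool) : Prop :=
  [/\ size t = size s, size p = size s &
      forall i, (i < size s)%N ->
        (nth ord0 s i + nth false p i = nth false t i + 1)%N].

(* [Jint] is a union over all compatible pairs; by [JintE] below each single
   compatible pair already gives the same set. *)
Definition Jint {R : realType} (lam : nat -> R) (s : seq 'I_3) : set R :=
  [set x | exists t p, compatible s t p /\
                       set_diff (Iint lam t) (Iint lam p) x].

Definition dig0 : 'I_3 := @Ordinal 3 0 isT.
Definition dig1 : 'I_3 := @Ordinal 3 1 isT.
Definition dig2 : 'I_3 := @Ordinal 3 2 isT.

(* The part of J_s outside its three children lying to the left ([i = false])
   or to the right ([i = true]) of the central child. *)
Definition gap {R : realType} (lam : nat -> R) (s : seq 'I_3) (i : bool) :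
    set R :=
  [set x | (Jint lam s `\` (Jint lam (rcons s dig0) `|`
                            Jint lam (rcons s dig1) `|`
                            Jint lam (rcons s dig2))) x /\
           forall y, Jint lam (rcons s dig1) y -> if i then y < x else x < y].

(* The digits i and i + 1, for i in {0, 1} *)
Definition digit (i : bool) : 'I_3 := if i then dig1 else dig0.
Definition digitS (i : bool) : 'I_3 := if i then dig2 else dig1.

(* [gap_gen lam k_ t m n] is G_t(n), as a set of subsets of the line. *)
Inductive gap_gen {R : realType} (lam : nat -> R) (k_ : nat -> nat)
    (t : seq 'I_3) (m : nat) : nat -> set (set R) :=
| gap_gen_left n : (m <= n)%N ->
    gap_gen lam k_ t m n
      (gap lam (t ++ nseq (k_ n - size t - 1) dig0) false)
| gap_gen_right n : (m <= n)%N ->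
    gap_gen lam k_ t m n
      (gap lam (t ++ nseq (k_ n - size t - 1) dig2) true)
| gap_gen_after l n (s : seq 'I_3) (i : bool) : (m <= l < n)%N ->
    size s = (k_ l - 1)%N -> gap_gen lam k_ t m l (gap lam s i) ->
    gap_gen lam k_ t m n
      (gap lam (s ++ digitS i :: nseq (k_ n - k_ l - 1) dig0) false)
| gap_gen_before l n (s : seq 'I_3) (i : bool) : (m <= l < n)%N ->
    size s = (k_ l - 1)%N -> gap_gen lam k_ t m l (gap lam s i) ->
    gap_gen lam k_ t m n
      (gap lam (s ++ digit i :: nseq (k_ n - k_ l - 1) dig2) true).

Definition gap_family {R : realType} (lam : nat -> R) (k_ : nat -> nat)
    (t : seq 'I_3) (m : nat) : set (set R) :=
  \bigcup_(n in [set n | (m <= n)%N]) gap_gen lam k_ t m n.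

Definition point_components {R : realType} (A : set R) : set R :=
  [set x | A x /\ connected_component A x = [set x]].

Definition is_cantorval {R : realType} (A : set R) : Prop :=
  [/\ A !=set0, regclosed A, bounded_set A &
      forall x, A x -> let K := connected_component A x in
        K° !=set0 ->
        limit_point (point_components A) (inf K) /\
        limit_point (point_components A) (sup K)].

Lemma dseqS {R : realType} (lam : nat -> R) n :
  dseq lam n.+1 = dseq lam n * lam n.+1.
Proof. by rewrite /dseq big_nat_recr. Qed.

Lemma descend_length {R : realType} (lam : nat -> R) t n (ab : R * R) :
  ab.2 - ab.1 = dseq lam n ->
  (descend lam n ab t).2 - (descend lam n ab t).1 = dseq lam (n + size t).
Proof.
elim: t n ab => [|e t IH] n ab H /=; first by rewrite addn0.
rewrite addnS -addSn; apply: IH; rewrite dseqS /child.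
by case: e => /=; rewrite -H; field.
Qed.

Lemma descend_left {R : realType} (lam : nat -> R) s t p t' p' n
    (a b a' b' : R * R) :
  compatible s t p -> compatible s t' p' ->
  a.2 - a.1 = dseq lam n -> b.2 - b.1 = dseq lam n ->
  a'.2 - a'.1 = dseq lam n -> b'.2 - b'.1 = dseq lam n ->
  a.1 - b.1 = a'.1 - b'.1 ->
  (descend lam n a t).1 - (descend lam n b p).1 =
  (descend lam n a' t').1 - (descend lam n b' p').1.
Proof.
elim: s t p t' p' n a b a' b' => [|x s IH] t p t' p' n a b a' b' [].
  by move=> /size0nil -> /size0nil -> _ [/size0nil -> /size0nil -> _].
case: t => // e t [st]; case: p => // f p [sp] h [].
case: t' => // e' t' [st']; case: p' => // f' p' [sp'] h' ha hb ha' hb' E.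
have ne q r u : u.2 - u.1 = dseq lam q ->
    (child lam q u r).2 - (child lam q u r).1 = dseq lam q.+1.
  by move=> H; rewrite dseqS /child; case: r => /=; rewrite -H; field.
apply: (IH t p t' p'); try exact: ne.
- by split=> // i hi; have := h i.+1 hi.
- by split=> // i hi; have := h' i.+1 hi.
have := h 0%N isT; have := h' 0%N isT => /=.
rewrite /child; case: e h => h; case: f h => h; case: e' h' => h';
  case: f' h' => h' /= E1 E2; try lra; exfalso; move: E1 E2; lia.
Qed.

Lemma JintE {R : realType} (lam : nat -> R) s t p : compatible s t p ->
  Jint lam s = set_diff (Iint lam t) (Iint lam p).
Proof.
move=> tp; apply/seteqP; split=> [x|x xtp]; last by exists t, p.
case=> t' [p' [tp' [y yI [z zI <-]]]].
have d01 : ((0, 1) : R * R).2 - ((0, 1) : R * R).1 = dseq lam 0.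
  by rewrite /dseq big_geq //= subr0.
have := descend_left tp tp' d01 d01 d01 d01 erefl.
have [[st sp _] [st' sp' _]] := (tp, tp').
have := descend_length t d01; have := descend_length p d01.
have := descend_length t' d01; have := descend_length p' d01.
rewrite st sp st' sp'; move: yI zI; rewrite /Iint /set_diff /= !in_itv /=.
move: (descend _ _ _ t) (descend _ _ _ p) (descend _ _ _ t')
  (descend _ _ _ p') => [a b] [a' b'] [c e] [c' e'] /=.
move=> /andP[? ?] /andP[? ?] ? ? ? ? ?.
exists (y - c + a); first by rewrite in_itv /=; apply/andP; split; lra.
exists (z - c' + a'); first by rewrite in_itv /=; apply/andP; split; lra.
lra.
Qed.

(* Main.v *)
(* By compactness, [C - C] is the intersection over [n] of the unions of the
   [J_s] with [|s| = n], and [J_s] is the interval of radius [d n] about a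
   centre [sum_i (s_i - 1) w_i] with [w_i = d i - d i.+1].

   The conditions on [delta] say that the intervals [J_s] of one generation
   organise themselves into chains: the centres in a chain form an arithmetic
   progression, and neighbours overlap in length exactly [delta n.+1] for the
   generations [r] with [k_n <= r < k_n.+1].  Passing to the next generation
   inside such a block turns a chain of [N] intervals into one of [3 N]
   intervals with the same union.  Passing to generation [k_n.+1] splits off
   the first and the last interval, while the [3 N - 2] remaining ones
   interlace into a single chain; so exactly two gaps appear per chain, those
   listed in [gap_gen].  This gives (1), the equality in (3), and the measure,
   since there are [3 ^ n] chains in the [n]-th block.

   The middle chain always contains a fixed neighbourhood of its centre, whence
   [C - C] is regular closed.  A point [p] of [C - C] with a gap on its right
   is the right end of every [J_s] of large generation containing it.  Since
   [2 d_{k_n} < w_{k_n - 1}] and [w] decreases, the points of [C - C] coming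
   from such [J_s] leave gaps arbitrarily close to [p] on the left, so [{p}] is
   a component.  The right end of a nondegenerate component is therefore not
   next to a gap, hence it is a limit of gaps, and of their left ends [p]. *)
Require Import Defs.
From HB Require Import structures.
From mathcomp Require Import all_boot all_order all_algebra.
From mathcomp Require Import all_classical all_reals all_analysis.
From mathcomp Require Import ring lra zify.

Set Implicit Arguments.
Unset Strict Implicit.
Unset Printing Implicit Defensive.

Import Order.TTheory GRing.Theory Num.Theory.
Import numFieldNormedType.Exports.

Local Open Scope classical_set_scope.
Local Open Scope ring_scope.

(** * Preliminaries on finite words and on neighbourhoods in the line *)

Lemma finite_size_eq (T : finType) n : finite_set [set s : seq T | size s = n].
Proof.
rewrite (_ : mkset _ = @tval n T @` setT).
  by apply: finite_image; exact: finite_finset.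
by apply/seteqP; split=> [s <-|_ [s _ <-]] /=; [exists (in_tuple s)|rewrite size_tuple].
Qed.

Lemma nbhs_symm_itv {R : realType} (x : R) (U : set R) :
  nbhs x U <-> exists2 e : R, 0 < e & forall y, x - e < y < x + e -> U y.
Proof.
split=> [/nbhs_ballP[e /= e0 eU]|[e e0 eU]].
  by exists e => // y h; apply: eU; rewrite /ball /= distrC ltr_distl.
apply/nbhs_ballP; exists e => //= y.
by rewrite /ball /= distrC ltr_distl; exact: eU.
Qed.

(** * One-point components near the right end of a component *)

Section RightIsolated.
Context {R : realType}.
Variable A : set R.

Definition right_isolated (p : R) :=
  exists2 e, 0 < e & forall z, p < z < p + e -> ~ A z.

Definition left_gaps (p : R) :=
  forall e, 0 < e -> exists2 z, p - e < z < p & ~ A z.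

Lemma connected_component_itv x : is_interval (connected_component A x).
Proof. exact/connected_intervalP/component_connected. Qed.

(** The component is an interval, so a second point in it would force into [A] either a missing
    point to the left of [p] or a point of the gap to its right. *)
Lemma right_isolated_point p : A p -> right_isolated p -> left_gaps p ->
  point_components A p.
Proof.
move=> Ap [e e0 pe] lg; split=> //; apply/seteqP; split; last first.
  by move=> _ ->; exact: connected_component_refl.
move=> q pq /=; have iA := @connected_component_itv p.
have pp := connected_component_refl Ap.
have sA := @connected_component_sub _ A p.
case: (ltgtP q p) => // h; exfalso.
  have [z /andP[z1 z2] []] := lg (p - q) ltac:(lra).
  by apply: sA; apply: (iA q p) => //; apply/andP; split; lra.
pose r := Num.min q (p + e / 2).
have [r1 r2] : r <= q /\ r <= p + e / 2 by rewrite /r !ge_min !lexx orbT.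
have r3 : p < r by rewrite /r lt_min h /=; lra.
apply: (pe r); first by apply/andP; split; lra.
by apply: sA; apply: (iA p q) => //; apply/andP; split; lra.
Qed.

(** The supremum [b] lies in [A], and [A] misses points arbitrarily close to the right of [b], since
    otherwise the component would extend. The last point of [A] before such a missing point is right
    isolated, hence a one-point component. *)
Lemma limit_point_sup_component x :
  closed A -> has_ubound A ->
  (forall p, A p -> right_isolated p -> left_gaps p) ->
  A x -> (connected_component A x)° !=set0 ->
  limit_point (point_components A) (sup (connected_component A x)).
Proof.
move=> clA ubA ri Ax K0.
set K := connected_component A x in K0 *; set b := sup K.
have sK : has_sup K.
  split; first by exists x; exact: connected_component_refl.
  case: ubA => u uA; exists u => z /connected_component_sub; exact: uA.
have Kb := sup_upper_bound sK; rewrite -/b in Kb.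
have iK : is_interval K := @connected_component_itv x.
have Kx : K x := connected_component_refl Ax.
have [y0 y0K y0b] : exists2 y0, K y0 & y0 < b.
  have [y /nbhs_symm_itv[r r0 rK]] := K0.
  exists y; first by apply: rK; apply/andP; split; lra.
  apply: (@lt_le_trans _ _ (y + r / 2)); first lra.
  by apply/Kb/rK; apply/andP; split; lra.
have ltK z : y0 <= z < b -> K z.
  move=> /andP[y0z zb]; have bz : 0 < b - z by lra.
  have [k Kk] := sup_adherent bz sK.
  rewrite -/b => kb; apply: (iK y0 k) => //; apply/andP; split=> //.
  lra.
have Ab : A b.
  rewrite (iffLR (closure_id A) clA).
  apply: (@closureS _ K); first exact: connected_component_sub.
  by apply: closure_sup; [exists x|case: sK].
have rgap e : 0 < e -> exists2 z, b < z < b + e & ~ A z.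
  move=> e0; apply: contrapT => h.
  suff /Kb : K (b + e / 2) by lra.
  apply: (connected_component_trans y0K).
  apply: (@connected_component_max _ A `[y0, b + e / 2]).
  - by rewrite /= in_itv /=; apply/andP; split; lra.
  - move=> z; rewrite /= in_itv /= => /andP[z1 z2].
    case: (ltgtP z b) => [zb|zb|-> //].
      by apply: (@connected_component_sub _ _ x); apply: ltK; rewrite z1.
    apply: contrapT => Az; apply: h; exists z => //; apply/andP; split; lra.
  - exact: segment_connected.
  by rewrite /= in_itv /=; apply/andP; split; lra.
move=> U /nbhs_symm_itv[e e0 eU].
have [y /andP[by_ ye] nAy] := rgap e e0.
(* The supremum [p] of [B] is the last point of [A] before the missing point [y]. *)
pose B := A `&` [set z | z <= y].
have sB : has_sup B by split; [exists b; split=> //=; exact: ltW|exists y => z []].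
pose p := sup B.
have Bp : B p.
  have clB : closed B by apply: closedI => //; exact: closed_le.
  by case: sB => B0 uB; have := closure_sup B0 uB; rewrite -(iffLR (closure_id B)).
have bp : b <= p by apply: sup_upper_bound => //; split=> //=; exact: ltW.
case: Bp => Ap /= py.
have {}py : p < y by rewrite lt_neqAle py andbT; apply/eqP => E; rewrite -E in nAy.
have rip : right_isolated p.
  exists (y - p); first by rewrite subr_gt0.
  move=> z /andP[pz zy] Az; suff : z <= p by lra.
  by apply: sup_upper_bound => //; split=> //=; lra.
have lgp := ri p Ap rip.
exists p; split.
(* The component fills the points from [y0] up to [b], so [b] has no gaps close to its left, whereas
   [p] has. *)
- apply/eqP => pb; rewrite pb in lgp.
  have [z /andP[z1 z2]] := lgp (b - y0) ltac:(lra).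
  by apply; apply: (@connected_component_sub _ _ x); apply: ltK; apply/andP; split; lra.
- exact: right_isolated_point.
- by apply: eU; apply/andP; split; lra.
Qed.

End RightIsolated.

(** * Reflection, carrying suprema to infima *)

Section Symmetric.
Context {R : realType}.
Variable A : set R.
Hypothesis A_opp : forall x, A x -> A (- x).

(** Negation is a continuous involution, so one inclusion, used at [x] and at [- x], gives both. *)
Lemma connected_component_opp x :
  -%R @` connected_component A x = connected_component A (- x).
Proof.
have sub z : -%R @` connected_component A z `<=` connected_component A (- z).
  move=> _ [y [B [Bz BA cB] By] <-]; exists (-%R @` B); last by exists y.
  split; first by exists z.
    by move=> _ [u Bu <-]; apply/A_opp/BA.
  apply: connected_continuous_connected => //.
  by apply: continuous_subspaceT; exact: opp_continuous.
apply/seteqP; split; first exact: sub.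
move=> y yA; exists (- y); last by rewrite opprK.
by rewrite -(opprK x); apply: sub; exists y.
Qed.

Lemma point_components_opp x : point_components A x -> point_components A (- x).
Proof.
move=> [Ax xE]; split; first exact: A_opp.
by rewrite -connected_component_opp xE image_set1.
Qed.

(** [inf] unfolds to minus the supremum of the reflected set, which is the component of [- x]. *)
Lemma limit_point_inf_component x :
  closed A -> has_ubound A ->
  (forall p, A p -> right_isolated A p -> left_gaps A p) ->
  A x -> (connected_component A x)° !=set0 ->
  limit_point (point_components A) (inf (connected_component A x)).
Proof.
move=> clA ubA ri Ax [y /nbhs_symm_itv[e e0 ye]] U.
rewrite /inf connected_component_opp => /nbhs_symm_itv[r r0 rU].
have := @limit_point_sup_component _ A (- x) clA ubA ri (A_opp Ax) _ (-%R @` U).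
case.
- exists (- y); apply/nbhs_symm_itv; exists e => // z /andP[z1 z2].
  rewrite -connected_component_opp; exists (- z); last by rewrite opprK.
  by apply: ye; apply/andP; split; lra.
- apply/nbhs_symm_itv; exists r => // z /andP[z1 z2].
  exists (- z); last by rewrite opprK.
  by apply: rU; apply/andP; split; lra.
move=> z [zs Az [u Uu uz]]; exists u; split=> //.
  by apply: contra_neq zs => uE; rewrite -uz uE opprK.
by rewrite -(opprK u) uz; exact: point_components_opp.
Qed.

End Symmetric.

(** * Finite lists of intervals and the removal of gaps from them *)

Section Refinement.
Context {R : realType}.
Implicit Types (L : seq (R * R)) (ab : R * R).

Definition hull L : set R :=
  [set x | exists2 ab, ab \in L & ab.1 <= x <= ab.2].

(* What remains of the hull of a chain at a generation [k_n]: the two end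
   intervals have length [l], the gaps next to them have length [w - l]. *)
Definition split3 (l w : R) ab : seq (R * R) :=
  [:: (ab.1, ab.1 + l); (ab.1 + w, ab.2 - w); (ab.2 - l, ab.2)].

Definition refine (l w : R) L : seq (R * R) := flatten (map (split3 l w) L).

Lemma mem_refine l w L cd :
  cd \in refine l w L <-> exists2 ab, ab \in L & cd \in split3 l w ab.
Proof. by split=> [/flatten_mapP|h]; last apply/flatten_mapP. Qed.

Definition gap_ends (l w : R) L : set (R * R) :=
  [set uv | exists2 ab, ab \in L &
     uv = (ab.1 + l, ab.1 + w) \/ uv = (ab.2 - w, ab.2 - l)].

Lemma hull_refine l w L x : hull L x ->
  (forall uv, gap_ends l w L uv -> ~ uv.1 < x < uv.2) -> hull (refine l w L) x.
Proof.
move=> [ab abL /andP[ax xb]] ng.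
have sub cd : cd \in split3 l w ab -> cd \in refine l w L.
  by move=> ?; apply/mem_refine; exists ab.
have g1 := ng (ab.1 + l, ab.1 + w) ltac:(by exists ab => //; left).
have g2 := ng (ab.2 - w, ab.2 - l) ltac:(by exists ab => //; right).
have [xl|xl] := leP x (ab.1 + l).
  exists (ab.1, ab.1 + l); last by rewrite ax xl.
  by apply: sub; rewrite !inE eqxx.
have [xr|xr] := leP (ab.2 - l) x.
  exists (ab.2 - l, ab.2); last by rewrite xr xb.
  by apply: sub; rewrite !inE eqxx !orbT.
exists (ab.1 + w, ab.2 - w); first by apply: sub; rewrite !inE eqxx orbT.
apply/andP; split; rewrite leNgt; apply/negP => h.
  by apply: g1; rewrite /= xl h.
by apply: g2; rewrite /= xr h.
Qed.

(** A gap turns its right end into a new left end. This and the mirror lemma reproduce the recursion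
    of [gap_gen], where new gaps are attached to both sides of old ones. *)
Lemma left_end_refine l w L x :
  (exists2 cd, cd \in refine l w L & x = cd.1) <->
  (exists2 ab, ab \in L & x = ab.1) \/
  (exists2 uv, gap_ends l w L uv & x = uv.2).
Proof.
split.
  move=> [cd /mem_refine[ab abL]]; rewrite !inE => /or3P[] /eqP -> ->.
  - by left; exists ab.
  - by right; exists (ab.1 + l, ab.1 + w) => //; exists ab => //; left.
  - by right; exists (ab.2 - w, ab.2 - l) => //; exists ab => //; right.
case=> [[ab abL ->]|[uv [ab abL [] ->] ->]].
- exists (ab.1, ab.1 + l) => //.
  by apply/mem_refine; exists ab; rewrite // !inE eqxx.
- exists (ab.1 + w, ab.2 - w) => //.
  by apply/mem_refine; exists ab; rewrite // !inE eqxx orbT.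
- exists (ab.2 - l, ab.2) => //.
  by apply/mem_refine; exists ab; rewrite // !inE eqxx !orbT.
Qed.

Lemma right_end_refine l w L x :
  (exists2 cd, cd \in refine l w L & x = cd.2) <->
  (exists2 ab, ab \in L & x = ab.2) \/
  (exists2 uv, gap_ends l w L uv & x = uv.1).
Proof.
split.
  move=> [cd /mem_refine[ab abL]]; rewrite !inE => /or3P[] /eqP -> ->.
  - by right; exists (ab.1 + l, ab.1 + w) => //; exists ab => //; left.
  - by right; exists (ab.2 - w, ab.2 - l) => //; exists ab => //; right.
  - by left; exists ab.
case=> [[ab abL ->]|[uv [ab abL [] ->] ->]].
- exists (ab.2 - l, ab.2) => //.
  by apply/mem_refine; exists ab; rewrite // !inE eqxx !orbT.
- exists (ab.1, ab.1 + l) => //.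
  by apply/mem_refine; exists ab; rewrite // !inE eqxx.
- exists (ab.1 + w, ab.2 - w) => //.
  by apply/mem_refine; exists ab; rewrite // !inE eqxx orbT.
Qed.

(** [gap_gen] consists of sets; this recovers the ends of a gap from the set alone. The midpoint of
    the first interval shows that the second is nonempty too. *)
Lemma open_itv_inj (u v u' v' : R) : u < v ->
  [set` `]u, v[] = [set` `]u', v'[] :> set R -> u = u' /\ v = v'.
Proof.
move=> uv E.
have mem x : u < x < v <-> u' < x < v'.
  by move/(congr1 (@^~ x)): E; rewrite /= !in_itv /= => ->.
have /mem/andP[z1 z2] : u < (u + v) / 2 < v by apply/andP; split; lra.
split; apply/eqP; rewrite eq_le !leNgt; apply/andP; split; apply/negP => h.
- have /mem/andP[? ?] : u' < (u + u') / 2 < v' by apply/andP; split; lra.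
  lra.
- have /mem/andP[? ?] : u < (u + u') / 2 < v by apply/andP; split; lra.
  lra.
- have /mem/andP[? ?] : u < (v + v') / 2 < v by apply/andP; split; lra.
  lra.
- have /mem/andP[? ?] : u' < (v + v') / 2 < v' by apply/andP; split; lra.
  lra.
Qed.

(** The bound [c] carries the right end of the preceding interval through inductions. *)
Fixpoint ordered (c : R) L : Prop :=
  if L is ab :: L' then [/\ c < ab.1, ab.1 <= ab.2 & ordered ab.2 L'] else True.

Lemma ordered_gt c L x : ordered c L -> hull L x -> c < x.
Proof.
elim: L c => [|ab L IH] c /=; first by move=> _ [].
move=> [c1 c2 oL] [cd]; rewrite inE => /predU1P[->|cdL] cdx.
  by case/andP: cdx => + _; exact: lt_le_trans.
have : hull L x by exists cd.
by move/(IH _ oL); apply: lt_trans; exact: lt_le_trans c2.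
Qed.

(** A width above [2 * w] keeps the middle part nondegenerate, and [l < w] separates it from the
    outer two. *)
Lemma ordered_refine l w c L : 0 < l < w -> ordered c L ->
  (forall ab, ab \in L -> 2 * w < ab.2 - ab.1) -> ordered c (refine l w L).
Proof.
move=> /andP[l0 lw]; elim: L c => [//|ab L IH] c /= [c1 c2 oL] wide.
have abw := wide ab (mem_head _ _).
do 3![split; rewrite /=; try lra].
by apply: IH => // cd cdL; apply: wide; rewrite inE cdL orbT.
Qed.

(** If the gap lies in the head of the list, [x] misses the three parts of the head and precedes the
    tail; if it lies in the tail, [x] is beyond the head. *)
Lemma gap_ends_refine l w c L uv x : 0 < l < w -> ordered c L ->
  (forall ab, ab \in L -> 2 * w < ab.2 - ab.1) ->
  gap_ends l w L uv -> uv.1 < x < uv.2 -> ~ hull (refine l w L) x.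
Proof.
move=> lw; have /andP[l0 l1] := lw.
elim: L c => [|ab L IH] c /= oL wide; first by move=> [].
case: oL => _ _ oL; have abw := wide ab (mem_head _ _).
have wideL cd : cd \in L -> 2 * w < cd.2 - cd.1.
  by move=> cdL; apply: wide; rewrite inE cdL orbT.
move=> [cd cdL uvE] xuv [ef ef_in /andP[x1 x2]].
move: cdL; rewrite inE => /predU1P[cdE|cdL].
  have {cdE cd uvE}[xg xab] : ~ (ab.1 <= x <= ab.1 + l \/
      ab.1 + w <= x <= ab.2 - w \/ ab.2 - l <= x <= ab.2) /\ x < ab.2.
    by rewrite cdE in uvE; case: uvE xuv => -> /andP[/= ? ?]; split;
      [case=> [/andP[]|[/andP[]|/andP[]]]; lra|lra|
       case=> [/andP[]|[/andP[]|/andP[]]]; lra|lra].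
  move/mem_refine: ef_in => [gh]; rewrite inE => /predU1P[->|ghL efgh].
    rewrite !inE => /or3P[] /eqP efE; apply: xg; rewrite efE /= in x1 x2.
    - by left; rewrite x1.
    - by right; left; rewrite x1.
    - by right; right; rewrite x1.
  have : hull (refine l w L) x.
    by exists ef; rewrite ?x1 //; apply/mem_refine; exists gh.
  by move/(ordered_gt (ordered_refine lw oL wideL)); lra.
have uvL : gap_ends l w L uv by exists cd.
move/mem_refine: ef_in => [gh]; rewrite inE => /predU1P[->|ghL efgh].
  have xL : ab.2 < x.
    have cdw := wideL _ cdL.
    have : ab.2 < cd.1.
      by apply: (ordered_gt oL); exists cd => //; apply/andP; split; lra.
    by case: uvE xuv => -> /andP[/= ? ?]; lra.
  by rewrite !inE => /or3P[] /eqP efE; rewrite efE /= in x1 x2; lra.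
apply: (IH _ oL wideL uvL xuv); exists ef; rewrite ?x1 //.
by apply/mem_refine; exists gh.
Qed.

Lemma hull_cons ab L : hull (ab :: L) = [set` `[ab.1, ab.2]] `|` hull L.
Proof.
apply/seteqP; split=> x.
  move=> [cd]; rewrite inE => /predU1P[->|cdL] xcd; last by right; exists cd.
  by left; rewrite /= in_itv.
case=> [|[cd cdL xcd]]; last by exists cd; rewrite // inE cdL orbT.
by rewrite /= in_itv => xab; exists ab; rewrite ?mem_head.
Qed.

Lemma measurable_hull L : measurable (hull L).
Proof.
elim: L => [|ab L IH].
  by rewrite (_ : hull _ = set0) //; apply/seteqP; split=> // x [].
by rewrite hull_cons; apply: measurableU => //; exact: measurable_itv.
Qed.

Lemma measure_hull c L : ordered c L ->
  lebesgue_measure (hull L) = (\sum_(ab <- L) (ab.2 - ab.1))%:E.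
Proof.
elim: L c => [|ab L IH] c /=.
  by rewrite (_ : hull _ = set0) ?measure0 ?big_nil //; apply/seteqP; split=> // x [].
move=> [_ c2 oL]; rewrite hull_cons.
transitivity (lebesgue_measure [set` `[ab.1, ab.2]] + lebesgue_measure (hull L))%E.
  apply: measureU; [exact: measurable_itv|exact: measurable_hull|].
  apply/seteqP; split=> // x [/=]; rewrite in_itv /= => /andP[_ xb].
  by move/(ordered_gt oL); lra.
rewrite (IH _ oL) big_cons EFinD lebesgue_measure_itv /= lte_fin.
by case: ltgtP c2 => // -> _; rewrite subrr.
Qed.

Lemma sum_refine l w L : \sum_(ab <- refine l w L) (ab.2 - ab.1) =
  \sum_(ab <- L) (ab.2 - ab.1) - 2 * (w - l) * (size L)%:R.
Proof.
elim: L => [|ab L IH]; first by rewrite !big_nil mulr0 subr0.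
by rewrite /refine /= !big_cons -/(refine l w L) IH -natr1 /=; ring.
Qed.

Lemma size_refine l w L : size (refine l w L) = (3 * size L)%N.
Proof. by elim: L => //= ab L ->; lia. Qed.

End Refinement.

(** * Coordinates for the intervals [I_t] and [J_s] *)

Section CentralCantor.
Context {R : realType}.
Variable lam : nat -> R.
Local Notation d := (dseq lam).

(** The distance between the left ends of the two children of an interval of generation [n], and
    between the centres of consecutive children of [J_s]. *)
Definition jump (n : nat) : R := dseq lam n - dseq lam n.+1.

Fixpoint centre (n : nat) (s : seq 'I_3) : R :=
  if s is e :: s' then ((e : nat)%:R - 1) * jump n + centre n.+1 s' else 0.

(** [offset 0 t] is the left end of [I_t]. The starting generation is a parameter, here and in
    [centre], so that words can be cut in two. *)
Fixpoint offset (n : nat) (t : seq bool) : R :=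
  if t is e :: t' then e%:R * jump n + offset n.+1 t' else 0.

Definition lo (s : seq 'I_3) : R := centre 0 s - dseq lam (size s).
Definition hi (s : seq 'I_3) : R := centre 0 s + dseq lam (size s).

Lemma dseq0 : dseq lam 0 = 1.
Proof. by rewrite /dseq big_geq. Qed.

Lemma centre_cat n s1 s2 :
  centre n (s1 ++ s2) = centre n s1 + centre (n + size s1) s2.
Proof.
elim: s1 n => [|e s IH] n /=; first by rewrite addn0 add0r.
by rewrite IH addrA addSnnS.
Qed.

Lemma centre_rcons n s e :
  centre n (rcons s e) = centre n s + ((e : nat)%:R - 1) * jump (n + size s).
Proof. by rewrite -cats1 centre_cat /= addr0. Qed.

Lemma centre_nseq0 n j : centre n (nseq j dig0) = dseq lam (n + j) - dseq lam n.
Proof.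
elim: j n => [|j IH] n /=; first by rewrite addn0 subrr.
by rewrite IH addSnnS /jump; ring.
Qed.

Lemma centre_nseq2 n j : centre n (nseq j dig2) = dseq lam n - dseq lam (n + j).
Proof.
elim: j n => [|j IH] n /=; first by rewrite addn0 subrr.
by rewrite IH addSnnS /jump; ring.
Qed.

Lemma lo_nseq0 s j : lo (s ++ nseq j dig0) = lo s.
Proof. by rewrite /lo centre_cat centre_nseq0 size_cat size_nseq; ring. Qed.

Lemma hi_nseq2 s j : hi (s ++ nseq j dig2) = hi s.
Proof. by rewrite /hi centre_cat centre_nseq2 size_cat size_nseq; ring. Qed.

Hypothesis lam_range : forall n, (1 <= n)%N -> 0 < lam n < 1 / 2.

Lemma dseq_gt0 n : 0 < dseq lam n.
Proof.
elim: n => [|n IH]; first by rewrite dseq0.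
rewrite dseqS mulr_gt0 //.
by have /andP[] := @lam_range n.+1 isT.
Qed.

Lemma dseqS_lt n : 2 * dseq lam n.+1 < dseq lam n.
Proof.
rewrite dseqS; have /andP[_ h] := @lam_range n.+1 isT.
have := dseq_gt0 n; nra.
Qed.

Lemma dseq_le n m : (n <= m)%N -> dseq lam m <= dseq lam n.
Proof.
move=> /subnKC <-; elim: (m - n)%N => [|j IH]; first by rewrite addn0.
rewrite addnS; have := dseqS_lt (n + j); have := dseq_gt0 (n + j).+1; lra.
Qed.

(** Each generation at least halves the length, whence [d n * n.+1] stays at most [1]. *)
Lemma dseq_small (e : R) : 0 < e -> exists n, dseq lam n < e.
Proof.
move=> e0; have bd n : dseq lam n * n.+1%:R <= 1.
  elim: n => [|n IH]; first by rewrite dseq0 mulr1.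
  have := dseqS_lt n; have := dseq_gt0 n.+1; move: IH.
  rewrite -!(natr1 n.+1) -!(natr1 n); have := ler0n R n; nra.
set N := Num.truncn e^-1; have h : e^-1 < N.+1%:R := truncnS_gt e^-1.
exists N.+1; have := bd N.+1; have := dseq_gt0 N.+1.
have ei : e * e^-1 = 1 by rewrite mulfV // gt_eqF.
rewrite -(natr1 N.+1) => d0 d1; rewrite ltNge; apply/negP => ed.
have : e * e^-1 < e * N.+1%:R by rewrite ltr_pM2l.
have := ler_wpM2r (ler0n R N.+1) ed; nra.
Qed.

Lemma jump_gt n : dseq lam n.+1 < jump n.
Proof. by rewrite /jump; have := dseqS_lt n; lra. Qed.

Lemma jump_gt0 n : 0 < jump n.
Proof. by apply: lt_trans (jump_gt n); exact: dseq_gt0. Qed.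

(** Consecutive jumps are separated by a length: [jump n.+1 < d n.+1 < jump n]. *)
Lemma jump_le n m : (n <= m)%N -> jump m <= jump n.
Proof.
move=> /subnKC <-; elim: (m - n)%N => [|j IH]; first by rewrite addn0.
apply: le_trans IH; rewrite addnS; apply/ltW.
apply: le_lt_trans (jump_gt _); rewrite /jump.
by have := dseq_gt0 (n + j).+2; lra.
Qed.

(** Each coefficient lies between [-1] and [1], and the sum of the jumps telescopes. *)
Lemma centre_bound n s :
  `|centre n s| <= dseq lam n - dseq lam (n + size s).
Proof.
elim: s n => [|e s IH] n /=; first by rewrite addn0 subrr normr0.
have := IH n.+1; rewrite addSnnS !ler_norml => /andP[h1 h2].
have e1 : ((e : nat)%:R : R) <= 2 by rewrite ler_nat; case: e => [[|[|[|]]]].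
have : -jump n <= ((e : nat)%:R - 1) * jump n <= jump n.
  by have := jump_gt0 n; have := ler0n R e; nra.
have : jump n = dseq lam n - dseq lam n.+1 by [].
by move: (_ * _) => x -> /andP[h3 h4]; apply/andP; split; lra.
Qed.

Lemma descend_offset t n (ab : R * R) : ab.2 - ab.1 = d n ->
  (descend lam n ab t).1 = ab.1 + offset n t.
Proof.
elim: t n ab => [|e t IH] n ab H /=; first by rewrite addr0.
have ch : (child lam n ab e).1 = ab.1 + e%:R * jump n /\
          (child lam n ab e).2 - (child lam n ab e).1 = d n.+1.
  by rewrite /jump dseqS /child; case: e => /=; rewrite -H; split; field.
by case: ch => E /IH ->; rewrite E addrA.
Qed.

Lemma IintE t : Iint lam t = [set` `[offset 0 t, offset 0 t + d (size t)]].
Proof.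
have d01 : ((0, 1) : R * R).2 - ((0, 1) : R * R).1 = d 0.
  by rewrite dseq0 subr0.
rewrite /Iint /=; have := descend_offset t d01; have := descend_length t d01.
by move=> /= /(canRL (subrK _)) -> ->; rewrite !add0r add0n addrC.
Qed.

Lemma centre_compatible n s t p : compatible s t p ->
  centre n s = offset n t - offset n p.
Proof.
elim: s n t p => [|e s IH] n t p [].
  by move=> /size0nil -> /size0nil ->; rewrite subrr.
case: t p => [|a t] // [|b p] //= [st] [sp] h.
rewrite (IH _ t p); last by split=> // i /(h i.+1).
have := h 0%N isT => /= E.
suff -> : ((e : nat)%:R : R) = a%:R - b%:R + 1 by ring.
by apply: (addIr b%:R); rewrite addrAC subrK -natrD E natrD.
Qed.

Lemma compatible_exists s : exists t p, compatible s t p.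
Proof.
(* The digits 2, 1, 0 are realised as the differences 1 - 0, 0 - 0, 0 - 1. *)
exists [seq e == dig2 | e <- s], [seq e == dig0 | e <- s].
split; rewrite ?size_map // => i si.
rewrite !(nth_map ord0) //.
by case: (nth ord0 s i) => [[|[|[|]]]].
Qed.

Lemma Jint_ball s :
  Jint lam s = [set x | `|x - centre 0 s| <= d (size s)].
Proof.
have [t [p tp]] := compatible_exists s.
have [st sp _] := tp.
rewrite (JintE lam tp) !IintE (centre_compatible _ tp) st sp.
apply/seteqP; split => x /=; rewrite ler_norml.
  case=> y + [z + <-]; rewrite /= !in_itv /= => /andP[? ?] /andP[? ?].
  by apply/andP; split; lra.
move=> /andP[h1 h2]; set u := x - (offset 0 t - offset 0 p) in h1 h2.
(* The sign of the deviation [u] decides which of the two intervals absorbs it; the other point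
   stays at its left end. *)
have [u0|u0] := leP 0 u.
  exists (offset 0 t + u); first by rewrite /= in_itv /=; apply/andP; split; lra.
  exists (offset 0 p); last by rewrite /u; ring.
  by rewrite /= in_itv /=; apply/andP; split; lra.
exists (offset 0 t); first by rewrite /= in_itv /=; apply/andP; split; lra.
exists (offset 0 p - u); last by rewrite /u; ring.
by rewrite /= in_itv /=; apply/andP; split; lra.
Qed.

Lemma JintP s x : Jint lam s x <-> lo s <= x <= hi s.
Proof.
rewrite Jint_ball /= ler_norml /lo /hi; split=> /andP[? ?]; apply/andP; split; lra.
Qed.

Lemma gap_false s : 3 * d (size s).+1 < d (size s) -> 0 < d (size s).+1 ->
  gap lam s false =
  [set` `]lo s + 2 * d (size s).+1, lo s + jump (size s)[].
Proof.
move=> h h'; apply/seteqP; split => x; rewrite /gap /=.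
  rewrite !JintP /lo /hi !size_rcons !centre_rcons /= add0n /jump.
  (* The centre of [J_s] lies in the middle child, so comparison with it tells on which side [x]
     is. *)
  move=> [[xJ n] /(_ (centre 0 s))].
  rewrite JintP /lo /hi !size_rcons !centre_rcons /= add0n /jump.
  move=> c; have {c} : x < centre 0 s by apply: c; apply/andP; split; lra.
  move=> xc; rewrite in_itv /=; apply/andP; split.
    rewrite ltNge; apply/negP => hx; apply: n; left; left.
    by move: xJ => /andP[? ?]; apply/andP; split; lra.
  rewrite ltNge; apply/negP => hx; apply: n; left; right.
  by move: xJ => /andP[? ?]; apply/andP; split; lra.
rewrite in_itv /= !JintP /lo /hi !size_rcons !centre_rcons /= add0n /jump.
move=> /andP[? ?]; split; last first.
  move=> y; rewrite JintP /lo /hi !size_rcons !centre_rcons /= add0n /jump.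
  by move=> /andP[? ?]; lra.
split; first by apply/andP; split; lra.
by case=> [[]|] /andP[? ?]; lra.
Qed.

Lemma gap_true s : 3 * d (size s).+1 < d (size s) -> 0 < d (size s).+1 ->
  gap lam s true =
  [set` `]hi s - jump (size s), hi s - 2 * d (size s).+1[].
Proof.
move=> h h'; apply/seteqP; split => x; rewrite /gap /=.
  rewrite !JintP /lo /hi !size_rcons !centre_rcons /= add0n /jump.
  move=> [[xJ n] /(_ (centre 0 s))].
  rewrite JintP /lo /hi !size_rcons !centre_rcons /= add0n /jump.
  move=> c; have {c} : centre 0 s < x by apply: c; apply/andP; split; lra.
  move=> xc; rewrite in_itv /=; apply/andP; split.
    rewrite ltNge; apply/negP => hx; apply: n; left; right.
    by move: xJ => /andP[? ?]; apply/andP; split; lra.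
  rewrite ltNge; apply/negP => hx; apply: n; right.
  by move: xJ => /andP[? ?]; apply/andP; split; lra.
rewrite in_itv /= !JintP /lo /hi !size_rcons !centre_rcons /= add0n /jump.
move=> /andP[? ?]; split; last first.
  move=> y; rewrite JintP /lo /hi !size_rcons !centre_rcons /= add0n /jump.
  by move=> /andP[? ?]; lra.
split; first by apply/andP; split; lra.
by case=> [[]|] /andP[? ?]; lra.
Qed.

Definition stage (n : nat) : set R :=
  \bigcup_(s in [set s : seq 'I_3 | size s = n]) Jint lam s.

Lemma closed_Jint s : closed (Jint lam s).
Proof.
rewrite (_ : Jint lam s = [set` `[lo s, hi s]]); first exact: itv_closed.
by apply/seteqP; split=> x; rewrite JintP /= in_itv.
Qed.

Lemma closed_stage n : closed (stage n).
Proof.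
apply: closed_bigcup; first exact: finite_size_eq.
by move=> s _; exact: closed_Jint.
Qed.

Lemma closed_Cstage n : closed (Cstage lam n).
Proof.
apply: closed_bigcup; first exact: finite_size_eq.
by move=> s _; rewrite IintE; exact: itv_closed.
Qed.

Lemma Jint_cat s1 s2 : Jint lam (s1 ++ s2) `<=` Jint lam s1.
Proof.
move=> x; rewrite !JintP /lo /hi centre_cat size_cat add0n.
have := centre_bound (size s1) s2.
rewrite ler_norml => /andP[? ?] /andP[? ?].
by apply/andP; split; lra.
Qed.

Lemma stage_le n m : (n <= m)%N -> stage m `<=` stage n.
Proof.
move=> nm x [s /= sm xs]; exists (take n s).
  by rewrite /= size_takel // sm.
by apply: (@Jint_cat _ (drop n s)); rewrite cat_take_drop.
Qed.

Lemma offset_cat n s1 s2 :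
  offset n (s1 ++ s2) = offset n s1 + offset (n + size s1) s2.
Proof.
elim: s1 n => [|e s IH] n /=; first by rewrite addn0 add0r.
by rewrite IH addrA addSnnS.
Qed.

Lemma offset_bound n t : 0 <= offset n t <= d n - d (n + size t).
Proof.
elim: t n => [|e t IH] n /=; first by rewrite addn0 subrr lexx.
have := IH n.+1; rewrite addSnnS => /andP[h1 h2].
have : 0 <= e%:R * jump n <= jump n.
  by have := jump_gt0 n; case: e; rewrite ?mul0r ?mul1r; lra.
have : jump n = d n - d n.+1 by [].
by move: (_ * _) => x -> /andP[h3 h4]; apply/andP; split; lra.
Qed.

Lemma Cstage_le n m : (n <= m)%N -> Cstage lam m `<=` Cstage lam n.
Proof.
move=> nm x [s /= sm]; rewrite IintE => xs; exists (take n s).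
  by rewrite /= size_takel // sm.
rewrite IintE; move: xs; rewrite -{1 2 3}(cat_take_drop n s) /= !in_itv /=.
rewrite offset_cat size_cat add0n.
have /andP[? ?] := offset_bound (size (take n s)) (drop n s).
by move=> /andP[? ?]; apply/andP; split; lra.
Qed.

Lemma central_cantorP x : central_cantor lam x <-> forall n, Cstage lam n x.
Proof.
split=> [h n|h n _]; last exact: h.
by apply: (@Cstage_le _ n.+1) => //; exact: h.
Qed.

Lemma stageP n x :
  stage n x <-> exists2 y, Cstage lam n y & Cstage lam n (y - x).
Proof.
split.
  move=> [s /= sn]; have [t [p tp]] := compatible_exists s.
  rewrite (JintE lam tp); case: tp => [st sp _] [y yt [z zp <-]].
  exists y; first by exists t => //=; rewrite st.
  by exists p; rewrite /= ?sp //; rewrite opprB addrC subrK.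
move=> [y [t /= tn yt] [p /= pn xp]].
have [s tp] : exists s, compatible s t p.
  exists [seq inord (ab.1 + 1 - ab.2) | ab : bool * bool <- zip t p].
  split; rewrite ?size_map ?size2_zip ?tn ?pn // => i ni.
  rewrite (nth_map (false, false)) ?size2_zip ?tn ?pn //.
  rewrite nth_zip ?tn ?pn //= inordK; case: (nth _ t i); case: (nth _ p i) => //.
exists s; first by case: tp => /= <-.
rewrite (JintE lam tp); exists y => //; exists (y - x) => //.
by rewrite opprB addrC subrK.
Qed.

(** For each [n] choose [y n] with [y n] and [y n - x] in the [n]-th stage. A cluster point [p] of
    these in [[0, 1]] lies with [p - x] in every stage, as the stages are closed and decreasing. *)
Lemma set_diff_stage :
  set_diff (central_cantor lam) (central_cantor lam) = \bigcap_n stage n.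
Proof.
apply/seteqP; split=> [_ [y /central_cantorP Cy [z /central_cantorP Cz <-]] n _|x].
  by apply/stageP; exists y; rewrite // opprB addrC subrK.
move=> xs; have /choice[y yC] n : exists y, Cstage lam n y /\ Cstage lam n (y - x).
  by have /stageP[y ? ?] := xs n I; exists y.
pose F := y @ \oo.
have FC n : F (Cstage lam n) /\ F [set z | Cstage lam n (z - x)].
  by split; exists n => // j /= nj; have [] := yC j;
    [move/(Cstage_le nj)|move=> _ /(Cstage_le nj)].
have [|p [_ pF]] := @segment_compact R 0 1 F _.
  have [+ _] := FC 0%N; apply: filterS => z [t /=].
  by rewrite IintE => /size0nil -> /=; rewrite dseq0 add0r.
rewrite clusterE in pF.
exists p; first apply/central_cantorP => n.
  have := pF _ (FC n).1; rewrite -(iffLR (closure_id _)) //.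
  exact: closed_Cstage.
exists (p - x); last by rewrite opprB addrC subrK.
apply/central_cantorP => n.
have := pF _ (FC n).2; rewrite -(iffLR (closure_id _)) //.
apply: (@closed_comp _ _ (fun z => z - x)); last exact: closed_Cstage.
by move=> z _; apply: cvgB; [exact: cvg_id|exact: cvg_cst].
Qed.

Lemma hi_stage s n : stage n (hi s).
Proof.
apply: (@stage_le n (size s + n)); first exact: leq_addl.
exists (s ++ nseq n dig2); first by rewrite /= size_cat size_nseq.
rewrite JintP hi_nseq2 lexx andbT -(hi_nseq2 s n) /lo /hi.
by have := dseq_gt0 (size (s ++ nseq n dig2)); lra.
Qed.

(** Digits 2 preserve the right end. The first other digit, at generation [j], lowers it by at least
    [jump j], which is at least the last jump. *)
Lemma hi_cat s u : hi (s ++ u) = hi s \/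
  hi (s ++ u) <= hi s - jump (size s + size u).-1.
Proof.
rewrite /hi centre_cat size_cat add0n.
suff : centre (size s) u + d (size s + size u) = d (size s) \/
    centre (size s) u + d (size s + size u) <=
    d (size s) - jump (size s + size u).-1 by case=> h; [left|right]; lra.
move: (size s) => n; elim: u n => [|e u IH] n /=; first by left; rewrite addn0 add0r.
rewrite addnS /=.
have je : jump n = d n - d n.+1 by [].
have := jump_gt0 n => j0.
have [e2|e1] : (e : nat) = 2 \/ (e <= 1)%N by move: e => [[|[|[|]]]]; tauto.
  rewrite e2; have := IH n.+1; rewrite addSn => -[h|h]; [left|right]; lra.
right; have := jump_le (leq_addr (size u) n).
have : ((e : nat)%:R : R) <= 1 by rewrite (ler_nat R e 1).
have := centre_bound n.+1 u; rewrite ler_norml => /andP[_].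
rewrite addSn; nra.
Qed.

(** * Gaps to the left of right isolated points *)

Section RightIsolatedPoints.
Hypothesis lam_lt_inf : forall N, exists n, (N < n)%N /\ lam n < 1 / 3.

Lemma stage_left_gaps p :
  (\bigcap_n stage n) p -> right_isolated (\bigcap_n stage n) p ->
  left_gaps (\bigcap_n stage n) p.
Proof.
move=> Ep [eta eta0 pE] e e0.
have [n dn] := dseq_small (divr_gt0 eta0 (ltr0n R 2)).
(* This closed set avoids [p], so all points close to [p] lie only in those [J_s] of generation [n]
   that contain [p]. *)
pose far := \bigcup_(s in [set s | size s = n /\ ~ Jint lam s p]) Jint lam s.
have : nbhs p (~` far).
  apply: open_nbhs_nbhs; split; last by move=> [s [_ ns]].
  apply: closed_openC; apply: closed_bigcup; last by move=> s _; exact: closed_Jint.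
  by apply: sub_finite_set (finite_size_eq _ n) => s [].
move=> /nbhs_symm_itv[r r0 rfar].
pose e' := Num.min e r.
have [e'0 e'e e'r] : [/\ 0 < e', e' <= e & e' <= r].
  by rewrite /e' lt_min e0 r0 !ge_min !lexx orbT.
have [N dN] := dseq_small e'0.
have [K [NK lamK]] : exists K, (n + N <= K)%N /\ lam K.+1 < 1 / 3.
  by have [[|K] [// NK lamK]] := lam_lt_inf (n + N); exists K.
have dK : d K < e' by apply: le_lt_trans dN; apply: dseq_le => //; lia.
have dK0 := dseq_gt0 K.+1.
have jK : 2 * d K.+1 < jump K by have := dseq_gt0 K; rewrite /jump dseqS; nra.
have jK' : jump K = d K - d K.+1 by [].
(* the middle of the last gap of the [J_s] with right end [p] *)
exists (p - (2 * d K.+1 + jump K) / 2); first by apply/andP; split; lra.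
set y := p - _ => /(_ K.+1 I)[s' /= ss'].
have [s [u [s'E sn]]] : exists s u, s' = s ++ u /\ size s = n.
  exists (take n s'), (drop n s'); rewrite cat_take_drop size_takel // ss'; lia.
move=> ys'; have ys : Jint lam s y by apply: (@Jint_cat s u); rewrite -s'E.
have ps : Jint lam s p.
  apply: contrapT => np; apply: (rfar y); last by exists s.
  by apply/andP; split; rewrite /y; lra.
have hs : hi s = p.
  move: ps; rewrite JintP => /andP[h1 h2].
  have hl : hi s = lo s + 2 * d n by rewrite /hi /lo sn; ring.
  apply/eqP; rewrite eq_le h2 andbT leNgt; apply/negP => h3.
  (* Otherwise the right end of [J_s] would be a point of the set to the right of [p], at distance
     at most [2 * d n < eta]. *)
  apply: (pE (hi s)); last by move=> j _; exact: hi_stage.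
  by rewrite h3 /=; lra.
have uK : (size s + size u = K.+1)%N by rewrite -size_cat -s'E.
move: ys'; rewrite JintP => /andP[h1 h2].
have hl : hi s' = lo s' + 2 * d K.+1 by rewrite /hi /lo ss'; ring.
(* If [J_s'] ends at [p], it starts to the right of [y]; otherwise it ends at or before
   [p - jump K], to the left of [y]. *)
have := hi_cat s u; rewrite -s'E uK hs /= => -[h|h]; rewrite /y in h1 h2; lra.
Qed.

End RightIsolatedPoints.

(** * Consequences of the conditions on [delta] *)

Section Blocks.
Variable k_ : nat -> nat.
Variable delta : nat -> R.
Hypothesis k_incr : forall n, (k_ n < k_ n.+1)%N.
Hypothesis lam_k : forall n, lam (k_ n.+1) < 1 / 3.
Hypothesis delta1 : forall n, (1 <= n)%N -> forall r, (k_ n.-1 < r < k_ n)%N ->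
  3 * d r - d r.-1 = delta n.
Hypothesis delta2 : forall n, (1 <= n)%N ->
  4 * d (k_ n) = delta n + delta n.+1.
Hypothesis delta3 : forall n, (1 <= n)%N ->
  d (k_ n).-1 - d (k_ n) = delta n - delta n.+1.

Lemma k_mono n m : (n <= m)%N -> (k_ n <= k_ m)%N.
Proof.
move=> /subnKC <-; elim: (m - n)%N => [|j IH]; first by rewrite addn0.
by rewrite addnS; apply: leq_trans IH (ltnW (k_incr _)).
Qed.

Lemma k_ge n : (n <= k_ n)%N.
Proof. by elim: n => // n IH; apply: leq_ltn_trans IH (k_incr n). Qed.

Lemma dseq_k n : 3 * d (k_ n.+1) < d (k_ n.+1).-1.
Proof.
case: (k_ n.+1) (k_ge n.+1) (lam_k n) => [//|r] _ /=.
by rewrite dseqS; have := dseq_gt0 r; nra.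
Qed.

(** By [dseq_k], the difference of the two terms exceeds [2 * d (k_ n.+1)], which is half of their
    sum. *)
Lemma delta_gt3 n : 3 * delta n.+2 < delta n.+1.
Proof. by have := dseq_k n; have := @delta2 n.+1 isT; have := @delta3 n.+1 isT; lra. Qed.

(** The sum of two consecutive terms is positive, while the second is below a third of the first. *)
Lemma delta_gt0 n : 0 < delta n.+1.
Proof.
have := delta_gt3 n; have := delta_gt3 n.+1; have := @delta2 n.+2 isT.
have := @delta2 n.+1 isT; have := dseq_gt0 (k_ n.+2).
have := dseq_gt0 (k_ n.+1); lra.
Qed.

(* Two neighbours in a chain of generation [r] overlap in length [delta n.+1],
   so their centres are this far apart. *)
Definition step (n r : nat) : R := 2 * d r - delta n.+1.

(** Centres spaced by three jumps have children evenly spaced by one jump, so a chain stays a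
    chain. *)
Lemma step_inner n r : (k_ n <= r)%N -> (r.+1 < k_ n.+1)%N ->
  step n r = 3 * jump r /\ step n r.+1 = jump r.
Proof.
move=> h1 h2; have := @delta1 n.+1 isT r.+1; rewrite /= ltnS h1 h2 => /(_ isT).
by rewrite /step /jump => <-; split; ring.
Qed.

Lemma step_outer n r : r.+1 = k_ n.+1 ->
  step n r = 3 / 2 * jump r /\ step n.+1 r.+1 = jump r / 2.
Proof.
move=> h; have := @delta2 n.+1 isT; have := @delta3 n.+1 isT; rewrite -h /=.
by rewrite /step /jump => *; split; lra.
Qed.

Lemma step_gt0 n r : (k_ n <= r < k_ n.+1)%N -> 0 < step n r.
Proof.
move=> /andP[h1]; rewrite leq_eqVlt => /predU1P[/step_outer|/(step_inner h1)] [-> _];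
  have := jump_gt0 r; lra.
Qed.

(** * Chains of intervals extending [t], and the gaps between them *)

Section Chains.
Variable t : seq 'I_3.
Variable m : nat.
Hypothesis t_block : (k_ m <= size t < k_ m.+1)%N.

Definition ext_centres (r : nat) : set R :=
  [set x | exists2 s, size (t ++ s) = r & x = centre 0 (t ++ s)].

Lemma ext_centresS r x : (size t <= r)%N ->
  ext_centres r.+1 x <->
  exists y (e : 'I_3), ext_centres r y /\ x = y + ((e : nat)%:R - 1) * jump r.
Proof.
move=> tr; split.
  case=> s; case/lastP: s => [|s e]; first by rewrite cats0; lia.
  rewrite -rcons_cat size_rcons => -[sr ->]; exists (centre 0 (t ++ s)), e.
  by rewrite centre_rcons add0n sr; split=> //; exists s.
case=> y [e [[s sr ->] ->]]; exists (rcons s e); rewrite -rcons_cat.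
  by rewrite size_rcons sr.
by rewrite centre_rcons add0n sr.
Qed.

(** [N] counts steps, so the chain filling [ab] has [N.+1] intervals. *)
Definition fits (n r : nat) (ab : R * R) (N : nat) : Prop :=
  ab.2 - ab.1 = 2 * d r + N%:R * step n r.

Definition chain (n r : nat) (ab : R * R) : set R :=
  [set x | exists N i, [/\ fits n r ab N, (i <= N)%N &
                           x = ab.1 + d r + i%:R * step n r]].

Definition described (n r : nat) (L : seq (R * R)) : Prop :=
  (forall ab, ab \in L -> exists N, fits n r ab N) /\
  (forall x, ext_centres r x <-> exists2 ab, ab \in L & chain n r ab x).

Lemma fits_uniq n r ab N M : (k_ n <= r < k_ n.+1)%N ->
  fits n r ab N -> fits n r ab M -> N = M.
Proof.
move=> /step_gt0 h0; rewrite /fits => -> /addrI /mulIf; rewrite gt_eqF //.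
by move=> /(_ isT) /eqP; rewrite eqr_nat => /eqP.
Qed.

Lemma fits_inner n r ab N : (k_ n <= r)%N -> (r.+1 < k_ n.+1)%N ->
  fits n r ab N -> fits n r.+1 ab (3 * N + 2).
Proof.
move=> h1 h2; have [e1 e2] := step_inner h1 h2.
rewrite /fits e1 e2 => ->; rewrite natrD natrM /jump; ring.
Qed.

(** The child with digit [e] of the [i]-th interval gets position [3 * i + e]; conversely a position
    is split by division by 3. The [N.+1] intervals become [3 * N + 3], hence the index
    [3 * N + 2]. *)
Lemma described_inner n r L : (size t <= r)%N -> (k_ n <= r)%N ->
  (r.+1 < k_ n.+1)%N -> described n r L -> described n r.+1 L.
Proof.
move=> tr h1 h2 [Lfit Lext]; have [e1 e2] := step_inner h1 h2.
have je : d r = jump r + d r.+1 by rewrite /jump; ring.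
split=> [ab /Lfit[N /(fits_inner h1 h2) abN]|x]; first by exists (3 * N + 2)%N.
rewrite ext_centresS //; split.
  move=> [_ [e [/Lext[ab abL [N [i [abN iN ->]]]] ->]]]; exists ab => //.
  exists (3 * N + 2)%N, (3 * i + e)%N; split; first exact: fits_inner.
    by have := ltn_ord e; lia.
  by rewrite e1 e2 je natrD natrM; ring.
move=> [ab abL [N' [i [abN' iN ->]]]]; have [N abN] := Lfit ab abL.
have NE : N' = (3 * N + 2)%N.
  by apply: fits_uniq abN' (fits_inner h1 h2 abN); rewrite h2 (leq_trans h1).
exists (ab.1 + d r + (i %/ 3)%:R * step n r), (Ordinal (ltn_pmod i (isT : (0 < 3)%N))).
split; last by rewrite e1 e2 je {1}(divn_eq i 3) natrD natrM /=; ring.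
by apply/Lext; exists ab => //; exists N, (i %/ 3)%N; split=> //; lia.
Qed.

(* In units of [jump r / 2], a chain has centres [3 i] for [i <= N], and their
   children [3 i - 2], [3 i], [3 i + 2] fill [0 .. 3 N], except for the first
   one, [-2], and the last one, [3 N + 2]. *)
Lemma described_outer n r L : (size t <= r)%N -> (k_ n <= r)%N ->
  r.+1 = k_ n.+1 -> described n r L ->
  described n.+1 r.+1 (refine (2 * d r.+1) (jump r) L).
Proof.
move=> tr h1 h2 [Lfit Lext]; have [e1 e2] := step_outer h2.
have je : d r = jump r + d r.+1 by rewrite /jump; ring.
have fl (ab : R * R) : fits n.+1 r.+1 (ab.1, ab.1 + 2 * d r.+1) 0 by rewrite /fits mul0r /=; ring.
have fr (ab : R * R) : fits n.+1 r.+1 (ab.2 - 2 * d r.+1, ab.2) 0 by rewrite /fits mul0r /=; ring.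
have fb ab N : fits n r ab N -> ab.2 = ab.1 + 2 * d r + N%:R * step n r.
  by rewrite /fits => E; rewrite -addrA -E; ring.
have fm ab N : fits n r ab N ->
    fits n.+1 r.+1 (ab.1 + jump r, ab.2 - jump r) (3 * N).
  by move=> /fb E; rewrite /fits /= E e1 e2 je natrM; field.
split=> [cd /mem_refine[ab /Lfit[N abN]]|x].
  rewrite !inE => /or3P[] /eqP ->; first (by exists 0%N); last (by exists 0%N).
  by exists (3 * N)%N; exact: fm.
rewrite ext_centresS //; split.
  move=> [_ [e [/Lext[ab abL [N [i [abN iN ->]]]] ->]]].
  have mid i' y : (i' <= 3 * N)%N -> y = ab.1 + d r + i'%:R * (jump r / 2) ->
      exists2 cd, cd \in refine (2 * d r.+1) (jump r) L & chain n.+1 r.+1 cd y.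
    move=> iN' ->; exists (ab.1 + jump r, ab.2 - jump r).
      by apply/mem_refine; exists ab => //; rewrite !inE eqxx orbT.
    by exists (3 * N)%N, i'; split; [exact: fm|by []|rewrite /= e2 je; ring].
  case: e => -[|[|[|//]]] /= _.
  - case: i iN => [_|i iN].
      exists (ab.1, ab.1 + 2 * d r.+1).
        by apply/mem_refine; exists ab => //; rewrite !inE eqxx.
      by exists 0%N, 0%N; split=> //=; rewrite je; ring.
    apply: (mid (3 * i + 1)%N); first lia.
    by rewrite e1 natrD natrM -natr1; field.
  - by apply: (mid (3 * i)%N); [lia|rewrite e1 natrM; field].
  - case: (ltnP i N) => [{}iN|Ni].
      apply: (mid (3 * i + 2)%N); first lia.
      by rewrite e1 natrD natrM; field.
    have -> : i = N by lia.
    exists (ab.2 - 2 * d r.+1, ab.2).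
      by apply/mem_refine; exists ab => //; rewrite !inE eqxx !orbT.
    by exists 0%N, 0%N; split=> //=; rewrite (fb _ _ abN) je; ring.
move=> [cd /mem_refine[ab abL cdab] [N' [i [cdN' iN ->]]]].
have [N abN] := Lfit ab abL.
have uniq M : fits n.+1 r.+1 cd M -> N' = M.
  by move=> cdM; apply: fits_uniq cdN' cdM; rewrite h2 leqnn k_incr.
have node j (e : 'I_3) y : (j <= N)%N ->
    y = ab.1 + d r + j%:R * step n r + ((e : nat)%:R - 1) * jump r ->
    exists z (e : 'I_3), ext_centres r z /\ y = z + ((e : nat)%:R - 1) * jump r.
  move=> jN ->; exists (ab.1 + d r + j%:R * step n r), e; split=> //.
  by apply/Lext; exists ab => //; exists N, j.
move: cdab uniq; rewrite !inE => /or3P[] /eqP -> uniq.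
- move: iN; rewrite (uniq _ (fl ab)) leqn0 => /eqP ->.
  by apply: (node 0%N dig0); rewrite //= je; ring.
- move: iN; rewrite (uniq _ (fm _ _ abN)) => iN.
  have := divn_eq i 3; have := ltn_pmod i (isT : (0 < 3)%N).
  (* Position [i] is the middle child of interval [i %/ 3], the left child of the next interval, or
     the right child of interval [i %/ 3]. *)
  case: (i %% 3)%N => [|[|[|//]]] _ iE.
  + apply: (node (i %/ 3)%N dig1); first lia.
    by rewrite {1}iE e1 e2 je natrD natrM /=; field.
  + apply: (node (i %/ 3).+1 dig0); first lia.
    by rewrite {1}iE e1 e2 je natrD natrM -[in RHS]natr1 /=; field.
  + apply: (node (i %/ 3)%N dig2); first lia.
    by rewrite {1}iE e1 e2 je natrD natrM /=; field.
- move: iN; rewrite (uniq _ (fr ab)) leqn0 => /eqP ->.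
  by apply: (node N dig2); rewrite //= (fb _ _ abN) je; ring.
Qed.

(* Block [j] consists of the generations [r] with [k_(m+j) <= r < k_(m+j).+1],
   so the [m] of the theorem is [m.+1] here.  The list [blocks j] holds the hulls
   of the chains, which do not change within the block. *)
Definition inner_len (j : nat) : R := 2 * d (k_ (m + j).+1).
Definition inner_shift (j : nat) : R := jump (k_ (m + j).+1).-1.

Fixpoint blocks (j : nat) : seq (R * R) :=
  if j is j'.+1 then refine (inner_len j') (inner_shift j') (blocks j')
  else [:: (lo t, hi t)].

Definition block_gap_ends (j : nat) : set (R * R) :=
  gap_ends (inner_len j) (inner_shift j) (blocks j).

Lemma t_lt j : (size t < k_ (m + j).+1)%N.
Proof.
have /andP[_ /leq_trans] := t_block; apply.
by rewrite -addSn; apply: k_mono; exact: leq_addr.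
Qed.

(** Induction on the generation, starting at [size t]: inside a block the list stays the same, and
    on reaching [k_ (m + j)] it is refined once. *)
Lemma described_blocks j r : (size t <= r)%N ->
  (k_ (m + j) <= r < k_ (m + j).+1)%N -> described (m + j) r (blocks j).
Proof.
move=> /subnKC <-; elim: (r - size t)%N j => [|i IH] j.
  rewrite addn0 => /andP[h1 h2].
  have -> : j = 0%N.
    case: j h1 {h2} => // j h1; have := t_lt j.
    by rewrite -addnS ltnNge h1.
  split=> [ab|x] /=.
    by rewrite inE => /eqP ->; exists 0%N; rewrite /fits mul0r /lo /hi /=; ring.
  split.
    case=> s; rewrite size_cat => /eqP; rewrite -[X in _ == X]addn0 eqn_add2l.
    move=> /nilP -> ->; exists (lo t, hi t); rewrite ?inE // cats0.
    exists 0%N, 0%N; split=> //; last by rewrite /lo /=; ring.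
    by rewrite /fits mul0r /lo /hi /=; ring.
  case=> ab; rewrite inE => /eqP -> [N [i [abN iN ->]]].
  have N0 : N = 0%N.
    apply: (@fits_uniq (m + 0) (size t) _ _ _ _ abN); first by rewrite addn0.
    by rewrite /fits mul0r /lo /hi /=; ring.
  move: iN; rewrite N0 leqn0 => /eqP ->; exists [::]; rewrite cats0 //.
  by rewrite /lo /=; ring.
rewrite addnS => /andP[h1 h2].
have [h3|h3] := leqP (k_ (m + j)) (size t + i).
  apply: described_inner => //; first exact: leq_addr.
  by apply: IH; rewrite h3 (ltn_trans _ h2).
have {h1 h3}h1 : (size t + i).+1 = k_ (m + j) by apply/eqP; rewrite eqn_leq h1 h3.
(* Block 0 cannot be entered from below, since it already contains the generation of [t]. *)
case: j h1 h2 => [|j] h1 h2.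
  by have /andP[] := t_block; rewrite -{1}(addn0 m) -h1; lia.
rewrite addnS in h1 *; rewrite /= /inner_len /inner_shift -h1 /=.
have h3 : (k_ (m + j) <= size t + i)%N by have := k_incr (m + j); lia.
apply: described_outer => //; first exact: leq_addr.
by apply: IH; rewrite h3 -h1 ltnSn.
Qed.

Lemma last_level j : (size t <= (k_ (m + j).+1).-1)%N /\
  (k_ (m + j) <= (k_ (m + j).+1).-1 < k_ (m + j).+1)%N.
Proof. by have := t_lt j; have := k_incr (m + j); lia. Qed.

Lemma inner_lenP j : 0 < inner_len j < inner_shift j.
Proof.
have := dseq_k (m + j); have := dseq_gt0 (k_ (m + j).+1).
rewrite /inner_len /inner_shift /jump prednK; last by have := t_lt j; lia.
by move=> *; apply/andP; split; lra.
Qed.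

(** At the last generation [r] of the block a chain has length at least [2 * d r], which exceeds
    [2 * jump r]. *)
Lemma blocks_width j ab : ab \in blocks j -> 2 * inner_shift j < ab.2 - ab.1.
Proof.
have [h1 h2] := last_level j; have [+ _ abL] := described_blocks h1 h2.
move=> /(_ _ abL)[N ->]; have := step_gt0 h2; have := ler0n R N.
have := dseq_gt0 (k_ (m + j).+1).-1.+1.
by rewrite /inner_shift /jump; nra.
Qed.

(** Since [delta] is positive, a step is at most the length of an interval, so the intervals of a
    chain leave no holes. *)
Lemma hull_blocks j x : hull (blocks j) x <->
  exists2 s, size (t ++ s) = (k_ (m + j).+1).-1 & Jint lam (t ++ s) x.
Proof.
have [h1 h2] := last_level j; have [Lfit Lext] := described_blocks h1 h2.
have s0 := step_gt0 h2.
have s1 : step (m + j) (k_ (m + j).+1).-1 <= 2 * d (k_ (m + j).+1).-1.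
  by rewrite /step; have := delta_gt0 (m + j); lra.
move: (k_ _).-1 => r in Lfit Lext h1 s0 s1 *.
split.
  case=> ab abL /andP[ax xb]; have [N abN] := Lfit ab abL.
  have {xb} : x <= ab.1 + 2 * d r + N%:R * step (m + j) r.
    by rewrite -addrA -abN; lra.
  (* Induction on the number of steps finds an interval of the chain containing [x]. *)
  suff H M : (M <= N)%N -> x <= ab.1 + 2 * d r + M%:R * step (m + j) r ->
      exists2 i, (i <= N)%N & `|x - (ab.1 + d r + i%:R * step (m + j) r)| <= d r.
    move=> /(H _ (leqnn N))[i iN].
    have [s sr sE] : ext_centres r (ab.1 + d r + i%:R * step (m + j) r).
      by apply/Lext; exists ab => //; exists N, i.
    by exists s => //; rewrite Jint_ball /= sr -sE.
  elim: M => [|M IH] MN xb.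
    by exists 0%N => //; rewrite ler_norml; apply/andP; split; lra.
  have [h|/ltW h] := leP x (ab.1 + 2 * d r + M%:R * step (m + j) r).
    by apply: IH => //; exact: ltnW.
  exists M.+1 => //; rewrite ler_norml; move: xb; rewrite -natr1 => xb.
  by apply/andP; split; lra.
case=> s sr; rewrite Jint_ball /= sr ler_norml => /andP[x1 x2].
have [ab abL [N [i [abN iN sE]]]] : exists2 ab, ab \in blocks j &
  chain (m + j) r ab (centre 0 (t ++ s)) by apply/Lext; exists s.
exists ab => //; rewrite sE in x1 x2; move: abN; rewrite /fits.
have : 0 <= (i%:R : R) by []; have : (i%:R : R) <= N%:R by rewrite ler_nat.
by move=> *; apply/andP; split; nra.
Qed.

(** The two alternatives correspond to the constructors [gap_gen_left] and [gap_gen_after]. *)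
Lemma left_end_blocks j x : (exists2 ab, ab \in blocks j & x = ab.1) <->
  x = lo t \/ exists2 i, (i < j)%N & exists2 uv, block_gap_ends i uv & x = uv.2.
Proof.
elim: j => [|j IH].
  split=> [[ab]|[->|[]//]]; first by rewrite inE => /eqP -> ->; left.
  by exists (lo t, hi t); rewrite ?inE.
rewrite /= left_end_refine IH; split.
  case=> [[->|[i ij h]]|h]; [by left|right; exists i => //; exact: ltnW|].
  by right; exists j.
case=> [->|[i]]; first by left; left.
rewrite ltnS leq_eqVlt => /predU1P[->|ij h]; first by right.
by left; right; exists i.
Qed.

Lemma right_end_blocks j x : (exists2 ab, ab \in blocks j & x = ab.2) <->
  x = hi t \/ exists2 i, (i < j)%N & exists2 uv, block_gap_ends i uv & x = uv.1.
Proof.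
elim: j => [|j IH].
  split=> [[ab]|[->|[]//]]; first by rewrite inE => /eqP -> ->; left.
  by exists (lo t, hi t); rewrite ?inE.
rewrite /= right_end_refine IH; split.
  case=> [[->|[i ij h]]|h]; [by left|right; exists i => //; exact: ltnW|].
  by right; exists j.
case=> [->|[i]]; first by left; left.
rewrite ltnS leq_eqVlt => /predU1P[->|ij h]; first by right.
by left; right; exists i.
Qed.

Lemma gap_itv n s i : size s = (k_ n.+1 - 1)%N ->
  [/\ gap lam s i =
      [set` `]hi (rcons s (digit i)), lo (rcons s (digitS i))[],
      (hi (rcons s (digit i)), lo (rcons s (digitS i))) =
      (if i then (hi s - jump (k_ n.+1).-1, hi s - 2 * d (k_ n.+1))
       else (lo s + 2 * d (k_ n.+1), lo s + jump (k_ n.+1).-1)) &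
      2 * d (k_ n.+1) < jump (k_ n.+1).-1].
Proof.
rewrite subn1 => ss; have := dseq_k n; have := dseq_gt0 (k_ n.+1).
have E : k_ n.+1 = (size s).+1 by have := k_ge n.+1; lia.
rewrite E /= => d0 d3.
have sE : (hi (rcons s (digit i)), lo (rcons s (digitS i))) =
    (if i then (hi s - jump (size s), hi s - 2 * d (size s).+1)
     else (lo s + 2 * d (size s).+1, lo s + jump (size s))).
  by case: i; congr pair;
    rewrite /lo /hi !centre_rcons !size_rcons /= add0n /jump; ring.
split; [|by []|by rewrite /jump; lra].
by case: i sE => -[-> ->]; rewrite ?gap_true ?gap_false.
Qed.

Lemma gap_gen_form n G : gap_gen lam k_ t m.+1 n.+1 G -> (m <= n)%N ->
  exists s i, size s = (k_ n.+1 - 1)%N /\ G = gap lam s i.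
Proof.
move=> h mn; have := t_lt (n - m); rewrite subnKC // => tn.
move: h; move E: n.+1 => n' h; rewrite E in tn; case: h E tn.
- move=> n1 _ En tn; exists (t ++ nseq (k_ n1 - size t - 1) dig0), false.
  by split; rewrite // size_cat size_nseq; lia.
- move=> n1 _ En tn; exists (t ++ nseq (k_ n1 - size t - 1) dig2), true.
  by split; rewrite // size_cat size_nseq; lia.
- move=> l n1 s i /andP[ml ln] sl _ _ _.
  exists (s ++ digitS i :: nseq (k_ n1 - k_ l - 1) dig0), false; split=> //.
  by rewrite size_cat /= size_nseq; have := k_mono ln; have := k_incr l;
    have := k_ge l; lia.
- move=> l n1 s i /andP[ml ln] sl _ _ _.
  exists (s ++ digit i :: nseq (k_ n1 - k_ l - 1) dig2), true; split=> //.
  by rewrite size_cat /= size_nseq; have := k_mono ln; have := k_incr l;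
    have := k_ge l; lia.
Qed.

(** Appended zeros keep the left end, so this is the left gap of any chain of block [j] starting at
    [lo s]. *)
Lemma gap_zeros j s i : (size s + i = k_ (m + j).+1 - 1)%N ->
  gap lam (s ++ nseq i dig0) false =
  [set` `]lo s + inner_len j, lo s + inner_shift j[].
Proof.
move=> si; have [|-> [-> ->] _] := @gap_itv (m + j) (s ++ nseq i dig0) false.
  by rewrite size_cat size_nseq.
by rewrite lo_nseq0.
Qed.

Lemma gap_twos j s i : (size s + i = k_ (m + j).+1 - 1)%N ->
  gap lam (s ++ nseq i dig2) true =
  [set` `]hi s - inner_shift j, hi s - inner_len j[].
Proof.
move=> si; have [|-> [-> ->] _] := @gap_itv (m + j) (s ++ nseq i dig2) true.
  by rewrite size_cat size_nseq.
by rewrite hi_nseq2.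
Qed.

Lemma size_next i j (s : seq 'I_3) : (i < j)%N -> size s = (k_ (m + i).+1 - 1)%N ->
  forall e, (size (rcons s e) + (k_ (m + j).+1 - k_ (m + i).+1 - 1) =
  k_ (m + j).+1 - 1)%N.
Proof.
move=> ij ss e; rewrite size_rcons ss; have := k_ge (m + i).+1.
have := @k_mono (m + i).+2 (m + j).+1 ltac:(lia); have := k_incr (m + i).+1.
lia.
Qed.

Lemma gap_gen_sub j G : gap_gen lam k_ t m.+1 (m + j).+1 G ->
  exists2 uv, block_gap_ends j uv & G = [set` `]uv.1, uv.2[].
Proof.
have left_gap i x : (exists2 ab, ab \in blocks i & x = ab.1) ->
    block_gap_ends i (x + inner_len i, x + inner_shift i).
  by case=> ab abL ->; exists ab => //; left.
have right_gap i x : (exists2 ab, ab \in blocks i & x = ab.2) ->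
    block_gap_ends i (x - inner_shift i, x - inner_len i).
  by case=> ab abL ->; exists ab => //; right.
have after l i (s : seq 'I_3) e : l = (m + i).+1 -> size s = (k_ l - 1)%N ->
    (exists2 uv, block_gap_ends i uv & gap lam s e = [set` `]uv.1, uv.2[]) ->
    exists2 uv, block_gap_ends i uv &
      hi (rcons s (digit e)) = uv.1 /\ lo (rcons s (digitS e)) = uv.2.
  move=> -> ss [uv uvi]; have [-> sE lw] := gap_itv e ss.
  by move=> /open_itv_inj[|? ?]; [case: e sE => -[-> ->]; lra|exists uv].
move E: (m + j).+1 => n h; elim: h j E => {n G}.
- move=> n _ j <-; exists (lo t + inner_len j, lo t + inner_shift j).
    by apply/left_gap/left_end_blocks; left.
  by apply: gap_zeros; have := t_lt j; lia.
- move=> n _ j <-; exists (hi t - inner_shift j, hi t - inner_len j).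
    by apply/right_gap/right_end_blocks; left.
  by apply: gap_twos; have := t_lt j; lia.
- move=> l n s i /andP[ml ln] sl _ IH j E.
  have [j' lE] : exists j', l = (m + j').+1 by exists (l - m.+1)%N; lia.
  have j'j : (j' < j)%N by lia.
  have [uv uvj [_ sE]] := after _ _ _ _ lE sl (IH _ (esym lE)).
  exists (uv.2 + inner_len j, uv.2 + inner_shift j).
    by apply/left_gap/left_end_blocks; right; exists j' => //; exists uv.
  rewrite -cat_rcons -E -sE; apply: gap_zeros; rewrite lE; apply: size_next => //.
  by rewrite -lE.
- move=> l n s i /andP[ml ln] sl _ IH j E.
  have [j' lE] : exists j', l = (m + j').+1 by exists (l - m.+1)%N; lia.
  have j'j : (j' < j)%N by lia.
  have [uv uvj [sE _]] := after _ _ _ _ lE sl (IH _ (esym lE)).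
  exists (uv.1 - inner_shift j, uv.1 - inner_len j).
    by apply/right_gap/right_end_blocks; right; exists j' => //; exists uv.
  rewrite -cat_rcons -E -sE; apply: gap_twos; rewrite lE; apply: size_next => //.
  by rewrite -lE.
Qed.

(** Strong induction on [j]: the gap is attached to an end of a chain, which is an end of [J_t] or
    of a gap from an earlier block. *)
Lemma gap_gen_sup j uv : block_gap_ends j uv ->
  gap_gen lam k_ t m.+1 (m + j).+1 [set` `]uv.1, uv.2[].
Proof.
have [n] := ubnP j; elim: n j uv => // n IH j uv jn [ab abL uvE].
have prev i xy : (i < j)%N -> block_gap_ends i xy -> exists s e,
    [/\ size s = (k_ (m + i).+1 - 1)%N,
        gap_gen lam k_ t m.+1 (m + i).+1 (gap lam s e),
        hi (rcons s (digit e)) = xy.1 & lo (rcons s (digitS e)) = xy.2].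
  move=> ij xyi; have G := IH i xy ltac:(lia) xyi.
  have [s [e [ss GE]]] := gap_gen_form G (leq_addr _ _).
  exists s, e; rewrite -GE; have [E _ _] := gap_itv e ss; rewrite E in GE.
  have [] // := open_itv_inj _ GE; case: xyi {GE G} => cd _.
  by have /andP[_ lw] := inner_lenP i; case=> -> /=; lra.
have tj := t_lt j; case: uvE => ->.
  have /left_end_blocks[->|[i ij [xy xyi ->]]] :
      exists2 cd, cd \in blocks j & ab.1 = cd.1 by exists ab.
    rewrite -(@gap_zeros _ _ (k_ (m + j).+1 - size t - 1)); last lia.
    by apply: gap_gen_left; lia.
  have [s [e [ss sG _ <-]]] := prev i xy ij xyi.
  rewrite -(gap_zeros (size_next ij ss _)) cat_rcons.
  by apply: gap_gen_after; rewrite // ltnS; lia.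
have /right_end_blocks[->|[i ij [xy xyi ->]]] :
    exists2 cd, cd \in blocks j & ab.2 = cd.2 by exists ab.
  rewrite -(@gap_twos _ _ (k_ (m + j).+1 - size t - 1)); last lia.
  by apply: gap_gen_right; lia.
have [s [e [ss sG <- _]]] := prev i xy ij xyi.
rewrite -(gap_twos (size_next ij ss _)) cat_rcons.
by apply: gap_gen_before; rewrite // ltnS; lia.
Qed.

Lemma hull_blocks_stage x : (forall j, hull (blocks j) x) -> (\bigcap_n stage n) x.
Proof.
move=> h n _; have /hull_blocks[s ss xs] := h n.
apply: (@stage_le n (k_ (m + n).+1).-1).
  by have := k_ge (m + n).+1; lia.
by exists (t ++ s).
Qed.

Lemma gap_free_stage :
  Jint lam t `\` \bigcup_(G in gap_family lam k_ t m.+1) G `<=` \bigcap_n stage n.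
Proof.
move=> x [xt xG]; apply: hull_blocks_stage.
elim=> [|j IH]; first by exists (lo t, hi t); rewrite ?inE //=; apply/JintP.
apply: hull_refine => // uv uvj xuv; apply: xG.
exists [set` `]uv.1, uv.2[]; last by rewrite /= in_itv.
by exists (m + j).+1; [rewrite /= ltnS leq_addr|exact: gap_gen_sup].
Qed.

(** Follow the middle part of each refinement: block by block its half-width drops by a difference
    of consecutive [delta], which telescopes to the half-width [q]. *)
Lemma central_interval x : ((size t).+1 < k_ m.+1)%N ->
  `|x - centre 0 t| <= d (size t) - delta m.+1 -> (\bigcap_n stage n) x.
Proof.
move=> tk xt; apply: hull_blocks_stage => j.
pose q := d (size t) - (delta m.+1 - delta (m + j).+1).
exists (centre 0 t - q, centre 0 t + q).
  rewrite /q; elim: j {q} => [|j IH]; first by rewrite addn0 subrr subr0 /= inE.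
  apply/mem_refine; eexists; first exact: IH.
  have := @delta3 (m + j).+1 isT; have := last_level j.
  rewrite !inE xpair_eqE /inner_shift /jump => h.
  rewrite prednK; last lia.
  by rewrite addnS => ->; apply/or3P/Or32/andP; split; apply/eqP => /=; ring.
have := delta_gt0 (m + j); move: xt; rewrite ler_norml /= /q => /andP[? ?] ?.
by apply/andP; split; lra.
Qed.

Lemma ordered_blocks j : ordered (lo t - 1) (blocks j).
Proof.
elim: j => [|j IH].
  by split; rewrite //= /lo /hi; have := dseq_gt0 (size t); lra.
by apply: ordered_refine => //; [exact: inner_lenP|exact: blocks_width].
Qed.

Lemma size_blocks j : size (blocks j) = (3 ^ j)%N.
Proof. by elim: j => // j IH; rewrite size_refine IH expnS. Qed.

Lemma hull_blocksS j : hull (blocks j.+1) `<=` hull (blocks j).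
Proof.
move=> x [cd /mem_refine[ab abL cdab] /andP[x1 x2]]; exists ab => //.
have /andP[l0 lw] := inner_lenP j; have := blocks_width abL.
move: cdab; rewrite !inE => /or3P[] /eqP cdE; rewrite cdE /= in x1 x2 => ?.
all: by apply/andP; split; lra.
Qed.

(** Each of the [3 ^ i] intervals of block [i] loses two gaps of length
    [inner_shift i - inner_len i]. *)
Lemma measure_blocks j : lebesgue_measure (hull (blocks j)) =
  (2 * d (size t) - 2 * \sum_(i < j)
     (3 ^+ i * (d (k_ (m + i).+1).-1 - 3 * d (k_ (m + i).+1))))%:E.
Proof.
rewrite (measure_hull (ordered_blocks j)); congr (_%:E); elim: j => [|j IH].
  by rewrite big_seq1 big_ord0 /lo /hi /=; ring.
rewrite /= sum_refine IH size_blocks big_ord_recr /= natrX.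
rewrite /inner_len /inner_shift /jump prednK; last by have := t_lt j; lia.
by ring.
Qed.

End Chains.

(** * The case of empty [t]: equality and measure *)

Section WholeLine.
Hypothesis k00 : k_ 0 = 0%N.
Local Notation blocks0 := (blocks [::] 0).

Let nil_block : (k_ 0 <= size ([::] : seq 'I_3) < k_ 1)%N.
Proof. by rewrite k00 /=; have := k_incr 0; lia. Qed.

Lemma stage_blocks : \bigcap_n stage n = \bigcap_j hull (blocks0 j).
Proof.
apply/seteqP; split=> x h; last first.
  by apply: (hull_blocks_stage nil_block) => j; exact: h.
move=> j _; apply/(hull_blocks nil_block).
by have [s ss xs] := h (k_ (0 + j).+1).-1 I; exists s.
Qed.

Lemma stage_gap_free :
  \bigcap_n stage n =
  Jint lam [::] `\` \bigcup_(G in gap_family lam k_ [::] 1) G.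
Proof.
apply/seteqP; split; last exact: gap_free_stage.
move=> x xs; split; first by have [s /= /size0nil ->] := xs 0%N I.
move=> [G [n /= n1 nG] Gx].
have [j nE] : exists j, n = (0 + j).+1 by exists n.-1; lia.
rewrite nE in nG; have [uv uvj GE] := gap_gen_sub nil_block nG.
move: Gx; rewrite GE /= in_itv /= => xuv.
have : (\bigcap_j hull (blocks0 j)) x by rewrite -stage_blocks.
move/(_ j.+1 I); apply: (gap_ends_refine (inner_lenP nil_block j)
  (ordered_blocks nil_block j) _ uvj xuv) => ab.
exact: blocks_width.
Qed.

Lemma measure_stage : lebesgue_measure (\bigcap_n stage n) =
  (2%:E - 2%:E * \sum_(1 <= n <oo)
     (3 ^+ n.-1 * (d (k_ n).-1 - 3 * d (k_ n)))%:E)%E.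
Proof.
pose S j : R := \sum_(i < j) (3 ^+ i * (d (k_ i.+1).-1 - 3 * d (k_ i.+1))).
have muS j : lebesgue_measure (hull (blocks0 j)) = (2 - 2 * S j)%:E.
  by rewrite measure_blocks // dseq0 mulr1.
have mb : measurable (\bigcap_j hull (blocks0 j)).
  by apply: bigcapT_measurable => j; exact: measurable_hull.
have : lebesgue_measure \o (fun j => hull (blocks0 j)) @ \oo -->
    lebesgue_measure (\bigcap_j hull (blocks0 j)).
  apply: nonincreasing_cvg_mu => //; first by rewrite [ltLHS]muS ltry.
    by move=> j; exact: measurable_hull.
  by apply/nonincreasing_seqP => j; apply/subsetPset; exact: hull_blocksS.
rewrite -stage_blocks.
(* These bounds make the measure a real number [v]; continuity from above then yields the
   convergence of the partial sums [S]. *)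
have : (lebesgue_measure (\bigcap_n stage n) <= 2%:E)%E.
  have -> : 2%:E = lebesgue_measure (hull (blocks0 0)).
    by rewrite muS /S big_ord0 mulr0 subr0.
  apply: le_measure; rewrite ?inE ?stage_blocks //; first exact: measurable_hull.
  by move=> x; apply.
have : (0 <= lebesgue_measure (\bigcap_n stage n))%E by exact: measure_ge0.
case: (lebesgue_measure (\bigcap_n stage n)) => [v _ _| _ |] //.
rewrite (_ : _ \o _ = EFin \o (fun j => 2 - 2 * S j)); last exact/funext/muS.
move=> /fine_cvg cv.
have cS : S @ \oo --> 1 - v / 2.
  rewrite (_ : S = (fun j => 1 - (2 - 2 * S j) / 2)); last first.
    by apply/funext => j; field.
  by apply: cvgB; [exact: cvg_cst|apply: cvgMl].
rewrite (_ : (\sum_(1 <= n <oo) _)%E = (1 - v / 2)%:E).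
  by rewrite -EFinM -EFinB; congr (_%:E); field.
apply/cvg_lim => //; rewrite -cvg_shiftS.
rewrite (_ : [sequence _]_n = EFin \o S); first by apply: cvg_EFin; [exact: nearW|].
apply/funext => j; rewrite /= big_add1 /= sumEFin big_mkord /S.
by congr (_%:E); apply: eq_bigr.
Qed.

End WholeLine.

(** * The set is regular closed *)

Section Regular.
Hypothesis lam_ge_inf : forall N, exists n, (N < n)%N /\ 1 / 3 <= lam n.

Lemma k_between n : (k_ 0 <= n)%N -> exists j, (k_ j <= n < k_ j.+1)%N.
Proof.
elim: n => [|n IH] h.
  by exists 0%N; rewrite h (leq_ltn_trans _ (k_incr 0)).
have [kn|kn] := leqP (k_ 0) n; last first.
  by exists 0%N; rewrite h (leq_ltn_trans kn).
have [j /andP[h1 h2]] := IH kn.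
have [h3|h3] := ltnP n.+1 (k_ j.+1); first by exists j; rewrite h3 ltnW.
by exists j.+1; rewrite h3 (leq_ltn_trans h2).
Qed.

Lemma closed_stages : closed (\bigcap_n stage n).
Proof. by apply: closed_bigI => n _; exact: closed_stage. Qed.

(** Near [x] take the centre of some [J_s] containing [x], with [n] and [n.+1] in the same block;
    [central_interval] surrounds this centre by points of the set. *)
Lemma regclosed_stages : regclosed (\bigcap_n stage n).
Proof.
apply/seteqP; split=> x.
  move/(closureS (@interior_subset _ _)).
  by rewrite -(iffLR (closure_id _) closed_stages).
move=> xE U /nbhs_symm_itv[e e0 eU].
have [N dN] := dseq_small e0.
have [n [Nn n3]] : exists n, (N + k_ 0 <= n)%N /\ 1 / 3 <= lam n.+1.
  by have [[|n] [// Nn n3]] := lam_ge_inf (N + k_ 0); exists n.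
have [j /andP[kj jk]] := @k_between n ltac:(lia).
have {}jk : (n.+1 < k_ j.+1)%N.
  rewrite ltn_neqAle jk andbT; apply/eqP => E.
  by have := lam_k j; rewrite -E ltNge n3.
have [s /= sn] := xE n I; rewrite Jint_ball /= sn ler_norml => /andP[x1 x2].
have dn : d n < e by apply: le_lt_trans dN; apply: dseq_le => //; lia.
exists (centre 0 s); split; last by apply: eU; apply/andP; split; lra.
(* By [step_inner] this radius equals [2 * d n - 3 * d n.+1], which is positive because
   [2 * d n.+1 < d n]. *)
apply/nbhs_symm_itv; exists (d n - delta j.+1).
  have [+ _] := step_inner kj jk.
  have := dseq_gt0 n; have := dseqS_lt n.
  by rewrite /step /jump; lra.
move=> y /andP[y1 y2].
apply: (@central_interval s j).
- by rewrite sn kj ltnW.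
- by rewrite sn.
by rewrite sn ler_norml; apply/andP; split; lra.
Qed.

End Regular.

End Blocks.

End CentralCantor.

(** * Assembly of the three conclusions *)

Theorem theorem2p5 (R : realType) (lam : nat -> R) (k_ : nat -> nat)
    (k m : nat) (t : k.-tuple 'I_3) (delta : nat -> R)
    (lam_range : forall n, (1 <= n)%N -> 0 < lam n < 1 / 2)
    (lam_lt_inf : forall N, exists n, (N < n)%N /\ lam n < 1 / 3)
    (lam_ge_inf : forall N, exists n, (N < n)%N /\ 1 / 3 <= lam n)
    (lam_k0 : 1 / 3 < lam (k_ 0%N).+1)
    (k_incr : forall n, (k_ n < k_ n.+1)%N)
    (k_enum : forall j, ((k_ 0%N < j)%N /\ lam j < 1 / 3) <->
                        exists n, (1 <= n)%N /\ j = k_ n)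
    (k0_le_k : (k_ 0%N <= k)%N)
    (m_ge1 : (1 <= m)%N)
    (m_k : (k_ m.-1 <= k < k_ m)%N)
    (delta1 : forall n, (1 <= n)%N -> forall r, (k_ n.-1 < r < k_ n)%N ->
       3 * dseq lam r - dseq lam r.-1 = delta n)
    (delta2 : forall n, (1 <= n)%N ->
       4 * dseq lam (k_ n) = delta n + delta n.+1)
    (delta3 : forall n, (1 <= n)%N ->
       dseq lam (k_ n).-1 - dseq lam (k_ n) = delta n - delta n.+1) :
  let C := central_cantor lam in
  let J_minus_gaps :=
    Jint lam t `\` \bigcup_(G in gap_family lam k_ t m) G in
  [/\ J_minus_gaps `<=` set_diff C C,
      is_cantorval (set_diff C C) &
      (k_ 0%N = 0%N -> k = 0%N -> tval t = [::] ->
       set_diff C C = J_minus_gaps /\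
       lebesgue_measure (set_diff C C) =
       (2%:E - 2%:E * \sum_(1 <= n <oo)
          (3 ^+ n.-1 * (dseq lam (k_ n).-1 - 3 * dseq lam (k_ n)))%:E)%E)].
Proof.
have lam_k n : lam (k_ n.+1) < 1 / 3.
  by have [_ [|//]] := k_enum (k_ n.+1); exists n.+1.
(* From here on [m] is one less than in the statement, matching the numbering of the blocks. *)
case: m m_ge1 m_k => // m _ /= m_k.
have t_block : (k_ m <= size t < k_ m.+1)%N by rewrite size_tuple.
rewrite set_diff_stage //; split.
- exact: (gap_free_stage lam_range k_incr lam_k delta1 delta2 delta3 t_block).
- have bound x : (\bigcap_n stage lam n) x -> `|x| <= 1.
    by move=> /(_ 0%N I)[s /= /size0nil ->]; rewrite Jint_ball /= subr0 dseq0.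
  have ubd : has_ubound (\bigcap_n stage lam n).
    by exists 1 => x /bound; rewrite ler_norml => /andP[].
  have clE := @closed_stages R lam.
  have gapE := stage_left_gaps lam_range lam_lt_inf.
  have oppE x : (\bigcap_n stage lam n) x -> (\bigcap_n stage lam n) (- x).
    rewrite -set_diff_stage // => -[a Ca [b Cb <-]].
    by exists b => //; exists a => //; rewrite opprB.
  split.
  + by exists (hi lam [::]) => n _; exact: hi_stage.
  + exact: (regclosed_stages lam_range k_incr lam_k delta1 delta2 delta3 lam_ge_inf).
  + by exists 1; split=> // M M1 x /bound xM; apply: le_trans xM (ltW M1).
  + move=> x Ex K K0; split; first exact: limit_point_inf_component.
    exact: limit_point_sup_component.
(* A positive [m] would give [k_ m <= 0], against strict monotonicity. *)
move=> k00 kE tE; have m0 : m = 0%N.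
  case: m m_k {t_block} => // m; rewrite kE leqn0 => /andP[/eqP km _].
  by have := k_incr m; rewrite km.
rewrite tE m0; split.
  exact: (stage_gap_free lam_range k_incr lam_k delta1 delta2 delta3 k00).
exact: (measure_stage lam_range k_incr lam_k delta1 delta2 delta3 k00).
Qed.
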